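(* Let $X\subset\mathbb{P}^{n-1}$ be a smooth non-degenerate totally real variety of dimension $d$, and let $k$ be an integer with $n-d\le k\le n-1$. Then the avoidance locus $\mathcal{A}_k(X)$ is an open subset of $\mathrm{Gr}(k,n)_{\mathbb{R}}$ (in the Euclidean topology), and it is a union of regions of $$\mathrm{Gr}(k,n)_{\mathbb{R}}\setminus \mathrm{CH}_{k+d-n+1}(X),$$ i.e. a (possibly empty) union of connected components of this complement.
   Context: Dimensions are projective dimensions. Varieties are complex projective and irreducible. $X\subset\mathbb{P}^{n-1}$ is non-degenerate if it is not contained in any hyperplane, and totally real if it is defined over $\mathbb{R}$ and its set of real points $X_{\mathbb{R}}$ is Zariski dense in $X$. $\mathrm{Gr}(k,n)$ is the Grassmannian of $(k-1)$-dimensional linear subspaces of $\mathbb{P}^{n-1}$, and $\mathrm{Gr}(k,n)_{\mathbb{R}}$ is its set of real points, with the Euclidean topology. $T_pX$ denotes the embedded (projective) tangent space of $X$ at $p$. An intersection $V\cap X$ with a linear space $V$ is transverse if $V$ and $T_pX$ together span $\mathbb{P}^{n-1}$ for every complex point $p\in V\cap X$ (so if $\dim V+\dim X<n-1$, transverse means empty). The $k$-th avoidance locus is $\mathcal{A}_k(X)=\{V\in\mathrm{Gr}(k,n)_{\mathbb{R}} : V\cap X \text{ is transverse and } V\cap X_{\mathbb{R}}=\varnothing\}$. For $0\le i\le d$, the $i$-th coisotropic variety (higher Chow locus) $\mathrm{CH}_i(X)\subseteq \mathrm{Gr}(n-d+i-1,n)$ is the Zariski closure of the set of all $L\in\mathrm{Gr}(n-d+i-1,n)$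 for which there is a smooth point $p$ of $X$ with $p\in L$ and $\dim(L\cap T_pX)\ge i$. A region is a connected component (in the Euclidean topology) of the complement of the real points of $\mathrm{CH}_i(X)$ in the real Grassmannian. *)

(* Defs.v *)
From HB Require Import structures.
From mathcomp Require Import all_boot all_order all_algebra.
From mathcomp Require Import generic_quotient complex mpoly.
From mathcomp Require Import boolp classical_sets reals topology.

Set Implicit Arguments.
Unset Strict Implicit.
Unset Printing Implicit Defensive.

Import GRing.Theory numFieldTopology.Exports.

Local Open Scope quotient_scope.
Local Open Scope classical_set_scope.
Local Open Scope ring_scope.

Section Grassmannian.
Variables (F : fieldType) (k n : nat).

Definition frames : set 'M[F]_(k, n) := [set A | row_free A].

Definition same_span (A B : frames) : bool := (val A == val B)%MS.

Lemma same_span_equiv : equiv_class_of same_span.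
Proof.
split=> [A|A B|B A C]; rewrite /same_span.
- exact/eqmxP.
- by apply/eqmxP/eqmxP => /eqmx_sym.
- by move=> /eqmxP eAB /eqmxP eBC; apply/eqmxP/(eqmx_trans eAB eBC).
Qed.

Canonical same_span_equiv_rel := EquivRelPack same_span_equiv.

(* Gr F k n is the set of k-dimensional linear subspaces of F^n, i.e. of
   (k-1)-dimensional projective subspaces of P^(n-1), as the quotient of the
   k-frames by equality of row spaces. In particular Gr F 1 n is P^(n-1). *)
Definition Gr : Type := {eq_quot same_span}.

HB.instance Definition _ := Quotient.copy Gr {eq_quot same_span}.

Definition Gr_mx (V : Gr) : 'M[F]_(k, n) := val (repr V).

Definition Gr_span (A : 'M[F]_(k, n)) (freeA : row_free A) : Gr :=
  \pi_Gr (exist _ A (mem_set freeA : A \in frames)).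

Lemma Gr_mx_free (V : Gr) : row_free (Gr_mx V).
Proof. exact: set_mem (valP (repr V)). Qed.

Lemma Gr_spanK (A : 'M[F]_(k, n)) (freeA : row_free A) :
  (Gr_mx (Gr_span freeA) :=: A)%MS.
Proof.
apply/eqmxP; rewrite /Gr_mx /Gr_span.
set a := exist _ _ _; have /eqmodP : repr (\pi_Gr a) = a %[mod Gr].
  by rewrite reprK.
by [].
Qed.

End Grassmannian.

Arguments Gr_mx {F k n}.

(* The Euclidean topology: the quotient of the topology of the set of frames as
   a subspace of the k x n matrices. *)
HB.instance Definition _ (R : realType) (k n : nat) :=
  Topological.copy (Gr R k n) (quotient_topology (Gr R k n)).

Definition points (F : fieldType) (k n : nat) (V : Gr F k n) : set (Gr F 1 n) :=
  [set p | (Gr_mx p <= Gr_mx V)%MS].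

Section Zariski.
Variable F : fieldType.

Definition homogeneous (N : nat) (f : {mpoly F[N]}) :=
  exists d, f \is d.-homog.

Definition pcoord (n : nat) (p : Gr F 1 n) : 'I_n -> F := Gr_mx p ord0.

Definition increasing (k n : nat) : {set {ffun 'I_k -> 'I_n}} :=
  [set s : {ffun 'I_k -> 'I_n} |
     [forall i : 'I_k, forall j : 'I_k, (i < j)%N ==> (s i < s j)%N]]%SET.

Definition plucker (k n : nat) (V : Gr F k n) : 'I_#|increasing k n| -> F :=
  fun s => \det (colsub (enum_val s) (Gr_mx V)).

(* c is a system of homogeneous coordinates on T: pcoord for T = P^(n-1),
   plucker for T = Gr(k, n). *)
Definition zariski_closed (T : Type) (N : nat) (c : T -> 'I_N -> F)
    (Z : set T) :=
  exists2 E : set {mpoly F[N]}, (forall f, E f -> homogeneous f) &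
    Z = [set x | forall f, E f -> f.@[c x] = 0].

Definition zariski_closure (T : Type) (N : nat) (c : T -> 'I_N -> F)
    (S : set T) : set T := smallest (zariski_closed c) S.

Definition zariski_irreducible (n : nat) (Z : set (Gr F 1 n)) :=
  Z !=set0 /\
  forall A B, zariski_closed (@pcoord n) A -> zariski_closed (@pcoord n) B ->
    Z `<=` A `|` B -> Z `<=` A \/ Z `<=` B.

Definition projective_variety (n : nat) (X : set (Gr F 1 n)) :=
  zariski_closed (@pcoord n) X /\ zariski_irreducible X.

Definition has_chain (n : nat) (X : set (Gr F 1 n)) (m : nat) :=
  exists Z : nat -> set (Gr F 1 n),
    (forall i, (i <= m)%N -> projective_variety (Z i) /\ Z i `<=` X) /\
    (forall i, (i < m)%N -> Z i `<` Z i.+1).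

(* Krull dimension *)
Definition variety_dim (n : nat) (X : set (Gr F 1 n)) (d : nat) :=
  has_chain X d /\ ~ has_chain X d.+1.

Definition nondegenerate_variety (n : nat) (X : set (Gr F 1 n)) :=
  forall H : Gr F n.-1 n, ~ X `<=` points H.

(* A matrix whose row space is the linear subspace S, see subspace_mxP. *)
Definition subspace_mx (n : nat) (S : set 'rV[F]_n) : 'M[F]_n :=
  xget 0 [set A : 'M[F]_n | forall v : 'rV_n, (v <= A)%MS <-> S v].

Lemma subspace_mxP (n : nat) (S : set 'rV[F]_n) :
  S 0 -> (forall a u v, S u -> S v -> S (a *: u + v)) ->
  forall v : 'rV_n, (v <= subspace_mx S)%MS <-> S v.
Proof.
move=> S0 Slin.
suff [A SA] : exists A : 'M[F]_n, forall v : 'rV_n, (v <= A)%MS <-> S v.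
  by rewrite /subspace_mx; case: xgetP => [B _ //|/(_ A)].
pose P r := `[< exists A : 'M[F]_n,
  \rank A = r /\ forall v : 'rV_n, (v <= A)%MS -> S v >].
have exP : exists r, P r.
  exists 0%N; apply/asboolP; exists 0; split; first by rewrite mxrank0.
  by move=> v; rewrite submx0 => /eqP ->.
have ubP r : P r -> (r <= n)%N.
  by move=> /asboolP[A [<- _]]; rewrite rank_leq_row.
case: (ex_maxnP exP ubP) => r /asboolP[A [rA SA]] maxr; exists A => v.
split; first exact: SA.
move=> Sv; have SAv w : (w <= (A + v)%MS)%MS -> S w.
  move=> /sub_addsmxP[[a b] /= ->]; rewrite addrC (mx11_scalar b) mul_scalar_mx.
  by apply: Slin => //; apply: SA; rewrite submxMl.
have rAv : (\rank (A + v)%MS <= \rank A)%N.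
  by rewrite rA; apply: maxr; apply/asboolP; exists (A + v)%MS.
apply: submx_trans (addsmxSr A v) _.
by move: rAv; rewrite (geq_leqif (mxrank_leqif_sup (addsmxSl A v))).
Qed.

(* The common zeros of the linear forms sum_j (df/dx_j)(p) x_j, for f in the
   homogeneous ideal of X. *)
Definition tangent_vectors (n : nat) (X : set (Gr F 1 n)) (p : Gr F 1 n) :
    set 'rV[F]_n :=
  [set v | forall f : {mpoly F[n]}, homogeneous f ->
    (forall q, X q -> f.@[pcoord q] = 0) ->
    \sum_(j < n) (f^`M(j)).@[pcoord p] * v ord0 j = 0].

Definition tangent_space (n : nat) (X : set (Gr F 1 n)) (p : Gr F 1 n) :
    'M[F]_n := subspace_mx (tangent_vectors X p).

Lemma tangent_spaceP (n : nat) (X : set (Gr F 1 n)) (p : Gr F 1 n)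
    (v : 'rV[F]_n) :
  (v <= tangent_space X p)%MS <-> tangent_vectors X p v.
Proof.
apply: subspace_mxP => [f _ _|a u w Tu Tw f hf fX].
  by rewrite big1 // => j _; rewrite mxE mulr0.
transitivity (a * (\sum_(j < n) (f^`M(j)).@[pcoord p] * u ord0 j) +
              \sum_(j < n) (f^`M(j)).@[pcoord p] * w ord0 j).
  rewrite mulr_sumr -big_split; apply: eq_bigr => j _.
  by rewrite !mxE mulrDr mulrCA.
by rewrite (Tu f hf fX) (Tw f hf fX) mulr0 addr0.
Qed.

(* The ranks are affine dimensions, one more than the projective ones. *)
Definition smooth_point (n : nat) (X : set (Gr F 1 n)) (p : Gr F 1 n) :=
  X p /\ exists2 d, variety_dim X d & \rank (tangent_space X p) = d.+1.

Definition smooth_variety (n : nat) (X : set (Gr F 1 n)) :=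
  forall p, X p -> smooth_point X p.

Definition transverse (k n : nat) (V : Gr F k n) (X : set (Gr F 1 n)) :=
  forall p, points V p -> X p -> row_full (Gr_mx V + tangent_space X p)%MS.

(* For X of dimension d this is CH_i(X) when k = n - d + i - 1; k is kept as a
   parameter because it occurs in the type of the ambient Grassmannian. The
   condition on the rank says that the projective dimension is at least i. *)
Definition coisotropic (n : nat) (X : set (Gr F 1 n)) (k i : nat) :
    set (Gr F k n) :=
  zariski_closure (@plucker k n)
    [set L | exists p, [/\ smooth_point X p, points L p &
       (i < \rank (Gr_mx L :&: tangent_space X p)%MS)%N]].

End Zariski.

Arguments coisotropic {F n} X k i.

Section Real.
Variable R : realType.

Lemma complexify_free (k n : nat) (V : Gr R k n) :
  row_free (map_mx (real_complex R) (Gr_mx V)).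
Proof. by rewrite row_free_map Gr_mx_free. Qed.

(* The real Grassmannian is identified with the set of real points of the
   complex one by extension of scalars. *)
Definition complexify (k n : nat) (V : Gr R k n) : Gr R[i] k n :=
  Gr_span (complexify_free V).

Definition real_points (n : nat) (X : set (Gr R[i] 1 n)) : set (Gr R[i] 1 n) :=
  X `&` range (@complexify 1 n).

Definition defined_over_reals (n : nat) (X : set (Gr R[i] 1 n)) :=
  exists2 E : set {mpoly R[n]}, (forall f, E f -> homogeneous f) &
    X = [set p | forall f, E f ->
           (map_mpoly (real_complex R) f).@[pcoord p] = 0].

Definition totally_real (n : nat) (X : set (Gr R[i] 1 n)) :=
  defined_over_reals X /\
  X `<=` zariski_closure (@pcoord _ n) (real_points X).

Definition avoidance_locus (n : nat) (X : set (Gr R[i] 1 n)) (k : nat) :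
    set (Gr R k n) :=
  [set V | transverse (complexify V) X /\
           points (complexify V) `&` real_points X = set0].

Definition region (n : nat) (X : set (Gr R[i] 1 n)) (k i : nat) :
    set (set (Gr R k n)) :=
  let U := ~` (@complexify k n @^-1` coisotropic X k i) in
  [set connected_component U V | V in U].

End Real.

Arguments avoidance_locus {R n} X k.
Arguments region {R n} X k i.

(* Main.v *)
(* A real subspace V is transverse to X iff it lies outside the coisotropic
   variety: L fails to be transverse at p iff L and T_pX meet in dimension more
   than expected, and the set of non-transverse L is Zariski closed by
   elimination theory (in an affine chart of the Grassmannian L is the row space
   of a matrix of Pluecker coordinates, and non-transversality says that a
   homogeneous system with parameters has a nontrivial solution).

   It remains to see that, among transverse V, having a real point in V and X is
   both a closed and an open condition in the Euclidean topology. It is closed by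
   compactness of the real projective space. For openness, let V meet X at the
   real point p. Choose c = codim X real equations f_i of X with independent
   differentials at p, and let g run over generators of the real ideal of X. All
   tangent spaces have the same dimension, so the (c+1)-minors of the Jacobian of
   (f, g) vanish on X, hence lie in the ideal. Therefore, near p, dg is a
   combination of the df_i up to an error bounded by the values of the generators.
   When V moves to V', follow p along V by Euler's method, staying tangent to the
   common zeros of the f_i: by a discrete Gronwall estimate the generators of the
   ideal remain as small as desired, so that by compactness V' meets X in a real
   point. This argument uses no dimension theory for X besides the constancy of
   the dimension of T_pX. *)
From HB Require Import structures.
Require Import Defs.
From mathcomp Require Import all_boot all_order all_algebra all_fingroup.
From mathcomp Require Import complex mpoly ring lra zify.
From mathcomp Require Import boolp classical_sets cardinality reals.
From mathcomp Require Import topology normedtype.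

Set Implicit Arguments.
Unset Strict Implicit.
Unset Printing Implicit Defensive.
Import Order.TTheory GRing.Theory Num.Theory numFieldTopology.Exports.
Local Open Scope quotient_scope.
Local Open Scope classical_set_scope.
Local Open Scope ring_scope.


(** * Polynomial ideals *)

(** The implicit function theorem for the [f_i] alone would give a nearby common zero of [c]
    equations, and placing that zero on [X] would require that these equations cut out [X] near [p].
    Carrying the values of all generators along the path avoids this: every minor of [(f, g)] is a
    polynomial combination of the generators, so the rate at which a generator changes in a
    direction tangent to the [f_i] is controlled by the current size of the generators, which is
    zero at the start. Hilbert's basis theorem makes the family of generators finite, hence the
    constants uniform. On the algebraic side, elimination rests on the fact that homogeneous
    equations without a nontrivial common zero generate all monomials of some degree; over the
    complex numbers this is derived from uncountability. Transversality concerns complex points but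
    the path is real, so complex equations are traded for their real and imaginary parts, which
    vanish on [X] because [X] is stable under conjugation. *)

Inductive ideal_span (F : comNzRingType) (n : nat) (E : {mpoly F[n]} -> Prop) :
    {mpoly F[n]} -> Prop :=
  | ideal_span0 : ideal_span E 0
  | ideal_spanMD u g h :
      E g -> ideal_span E h -> ideal_span E (u * g + h).

Section IdealSpan.
Variables (F : comNzRingType) (n : nat).
Implicit Types (E : {mpoly F[n]} -> Prop) (f g h u : {mpoly F[n]}).

Lemma ideal_span_mem E g : E g -> ideal_span E g.
Proof.
by move=> Eg; rewrite -[g]addr0 -[g]mul1r; apply/ideal_spanMD/ideal_span0.
Qed.

Lemma ideal_spanD E f g :
  ideal_span E f -> ideal_span E g -> ideal_span E (f + g).
Proof.
elim=> [|u p h Ep _ IH] Eg; first by rewrite add0r.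
by rewrite -addrA; apply: ideal_spanMD => //; apply: IH.
Qed.

Lemma ideal_spanM E u f : ideal_span E f -> ideal_span E (u * f).
Proof.
elim=> [|v p h Ep _ IH]; first by rewrite mulr0; apply: ideal_span0.
by rewrite mulrDr mulrA; apply: ideal_spanMD.
Qed.

Lemma ideal_spanN E f : ideal_span E f -> ideal_span E (- f).
Proof. by move=> /(ideal_spanM (-1)); rewrite mulN1r. Qed.

Lemma ideal_spanB E f g :
  ideal_span E f -> ideal_span E g -> ideal_span E (f - g).
Proof. by move=> Ef /ideal_spanN; apply: ideal_spanD. Qed.

Lemma ideal_span_sum E (I : Type) (r : seq I) (P : pred I)
    (f : I -> {mpoly F[n]}) :
  (forall i, P i -> ideal_span E (f i)) ->
  ideal_span E (\sum_(i <- r | P i) f i).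
Proof.
move=> Ef; elim/big_ind: _ => //; first exact: ideal_span0.
exact: ideal_spanD.
Qed.

Lemma ideal_span_sub E E' f : (forall g, E g -> ideal_span E' g) ->
  ideal_span E f -> ideal_span E' f.
Proof.
move=> EE'; elim=> [|u g h Eg _ IH]; first exact: ideal_span0.
by apply: ideal_spanD => //; apply/ideal_spanM/EE'.
Qed.

End IdealSpan.

(** Every index is chosen so that [f] attains there its minimum over a final segment of the indices;
    later choices can then only give values at least as large. *)
Lemma nondecreasing_subseq (f : nat -> nat) :
  exists2 phi : nat -> nat, {homo phi : i j / (i < j)%N} &
    {homo f \o phi : i j / (i <= j)%N}.
Proof.
have /choice[m mP] (N : nat) :
    exists p : nat, (N <= p)%N /\ forall q, (N <= q)%N -> (f p <= f q)%N.
  pose P v := `[< exists2 p, (N <= p)%N & f p = v >].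
  have exP : exists v, P v by exists (f N); apply/asboolP; exists N.
  case: (ex_minnP exP) => v /asboolP[p Np fp] vmin.
  by exists p; split=> // q Nq; rewrite fp; apply/vmin/asboolP; exists q.
pose phi := fix phi i := if i is j.+1 then m (phi j).+1 else m 0%N.
exists phi.
  by apply: homo_ltn => [i|i] /=; [exact: ltn_trans|case: (mP (phi i).+1)].
apply: homo_leq => [i||i]; [exact: leqnn|exact: leq_trans|].
case: i => [|i] /=; first by case: (mP 0%N) => _; apply.
have [_ min_i] := mP (phi i).+1; apply: min_i.
have [le1 _] := mP (phi i).+1; have [le2 _] := mP (m (phi i).+1).+1.
by apply: leq_trans le1 _; apply: ltnW.
Qed.

(** Subsequences are refined one variable at a time, until all exponents are nondecreasing along the
    same subsequence; its first two terms then compare. *)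
Lemma dickson (n : nat) (f : nat -> 'X_{1..n}) :
  exists i j, (i < j)%N /\ (f i <= f j)%MM.
Proof.
suff: forall s : seq 'I_n, exists2 phi : nat -> nat,
    {homo phi : i j / (i < j)%N} &
    forall a, a \in s -> {homo (fun i => f (phi i) a) : i j / (i <= j)%N}.
  move=> /(_ (enum 'I_n))[phi phi_inc f_inc]; exists (phi 0%N), (phi 1%N).
  split; first exact: phi_inc.
  by apply/mnm_lepP => a; apply: f_inc (leqnSn 0); rewrite mem_enum.
elim=> [|a s [phi phi_inc f_inc]]; first by exists id.
have [psi psi_inc fa_inc] := nondecreasing_subseq (fun i => f (phi i) a).
exists (phi \o psi) => [i j /psi_inc/phi_inc //|b].
rewrite inE => /predU1P[-> //|bs] i j ij /=; apply: f_inc => //.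
by move: ij; rewrite leq_eqVlt => /predU1P[-> //|/psi_inc/ltnW].
Qed.

(* A counterexample would produce a sequence r_0, r_1, ... in which r_i has
   minimal leading monomial modulo the ideal of r_0, ..., r_(i-1); by Dickson's
   lemma some r_j could then be reduced by an earlier r_i. *)
Theorem hilbert_basis (F : fieldType) (n : nat) (E : {mpoly F[n]} -> Prop) :
  exists2 s : seq {mpoly F[n]}, (forall g, g \in s -> E g) &
    forall f, E f -> ideal_span (fun g => g \in s) f.
Proof.
apply: contrapT => noE.
have /choice[next nextP] (s : seq {mpoly F[n]}) : exists f,
    (forall g, g \in s -> E g) ->
    E f /\ ~ ideal_span (fun g => g \in s) f.
  have [sE|] := pselect (forall g, g \in s -> E g); last by exists 0.
  apply: contrapT => nof; apply: noE; exists s => // f Ef.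
  by apply: contrapT => fs; apply: nof; exists f.
pose S := fix S i := if i is j.+1 then next (S j) :: S j else [::].
have SE i : forall g, g \in S i -> E g.
  elim: i => //= i IH g; rewrite inE => /predU1P[->|]; last exact: IH.
  by have [] := nextP _ IH.
have SS i j f : (i <= j)%N -> ideal_span (fun g => g \in S i) f ->
    ideal_span (fun g => g \in S j) f.
  move=> ij; apply: ideal_span_sub => g gi; apply: ideal_span_mem.
  elim: j ij => [|j IH]; first by rewrite leqn0 => /eqP i0; rewrite i0 in gi.
  by rewrite leq_eqVlt => /predU1P[<- //|/IH gj]; rewrite inE gj orbT.
have /choice[r rP] (i : nat) : exists r,
    ideal_span (fun g => g \in S i) (next (S i) - r) /\
    forall r', ideal_span (fun g => g \in S i) (next (S i) - r') ->
      (mlead r <= mlead r')%O.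
  pose P m := exists2 r, ideal_span (fun g => g \in S i) (next (S i) - r) &
    mlead r = m.
  suff [m [[r rS rm] mmin]] : exists m, P m /\ forall m', P m' -> (m <= m')%O.
    by exists r; split=> // r' r'S; rewrite rm; apply: mmin; exists r'.
  have exP : exists m, P m.
    exists (mlead (next (S i))), (next (S i)) => //.
    by rewrite subrr; apply: ideal_span0.
  apply: contrapT => nomin; case: exP => m.
  elim/(well_founded_ind (@ltom_wf n)): m => m IH Pm.
  apply: nomin; exists m; split=> // m' Pm'; rewrite leNgt; apply/negP => lt.
  exact: IH lt Pm'.
have r_neq0 i : r i != 0.
  apply/eqP => ri0; have [] := nextP (S i) (@SE i).
  by have [] := rP i; rewrite ri0 subr0.
have [i [j [ij /submK lead_ij]]] := dickson (fun i => mlead (r i)).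
have [rjS rjmin] := rP j; have [riS _] := rP i.
pose c := mleadc (r j) / mleadc (r i).
pose q := c *: 'X_[mlead (r j) - mlead (r i)] * r i.
have lci : mleadc (r i) != 0 by rewrite mleadc_eq0.
have c0 : c != 0 by rewrite mulf_neq0 ?invr_eq0 ?mleadc_eq0.
have q_lead : mlead q = mlead (r j).
  rewrite mleadM // ?mleadZ ?mleadXm //.
  by rewrite scaler_eq0 negb_or c0 -mleadc_eq0 mleadXm mcoeffX eqxx oner_eq0.
have q_leadc : q@_(mlead (r j)) = mleadc (r j).
  by rewrite /q -scalerAl mcoeffZ [_ * r i]mulrC -[X in _@_X]lead_ij mcoeffMX divfK.
have qS : ideal_span (fun g => g \in S j) q.
  apply: ideal_spanM; apply: (SS i.+1) => //.
  have -> : r i = next (S i) - (next (S i) - r i) by rewrite opprB addrC subrK.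
  apply: ideal_spanB; first by apply: ideal_span_mem; rewrite inE eqxx.
  exact: SS (leqnSn i) riS.
have r'S : ideal_span (fun g => g \in S j) (next (S j) - (r j - q)).
  by rewrite opprB addrCA addrC; apply: ideal_spanD.
have lead_le : (mlead (r j - q) <= mlead (r j))%O.
  by apply: le_trans (mleadB_le _ _) _; rewrite q_lead joinxx.
(* By minimality of [r j] the leading monomial cannot drop, yet [q] was scaled to cancel the leading
   term. So [r j - q = 0], and [next (S j)] lies in the ideal of the elements chosen before it. *)
have lead_eq : mlead (r j - q) = mlead (r j).
  by apply/le_anti; rewrite lead_le rjmin.
have : r j - q == 0 by rewrite -mleadc_eq0 lead_eq mcoeffB q_leadc subrr.
move=> /eqP r'0; have [_] := nextP (S j) (@SE j); apply.
by move: r'S; rewrite r'0 subr0.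
Qed.


(** * The Nullstellensatz over an uncountable field *)

Lemma interval_avoiding (R : realFieldType) (s : seq R) (a b : R) : a < b ->
  exists a' b', [/\ a <= a', a' < b', b' <= b &
    forall x, x \in s -> ~ a' <= x <= b'].
Proof.
move=> ab; elim: s => [|x s [c [d [ac cd db sP]]]]; first by exists a, b.
have [cm md] := midf_lt cd; set m := (c + d) / 2 in cm md.
have [xm|mx] := leP x m.
- have [me ed] := midf_lt md; set e := (m + d) / 2 in me ed.
  exists e, d; split=> //; first exact: le_trans ac (ltW (lt_trans cm me)).
  move=> y; rewrite inE => /predU1P[-> /andP[ex _]|/sP sy /andP[ey yd]].
    by have := lt_le_trans me (le_trans ex xm); rewrite ltxx.
  by apply: sy; rewrite (le_trans _ ey) ?yd // ltW // (lt_trans cm).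
- exists c, m; split=> //; first exact: le_trans (ltW md) db.
  move=> y; rewrite inE => /predU1P[-> /andP[_ xm]|/sP sy /andP[cy ym]].
    by have := lt_le_trans mx xm; rewrite ltxx.
  by apply: sy; rewrite cy (le_trans ym) // ltW.
Qed.

(** Cantor's nested intervals: if every fibre were contained in a finite list [s d], a point [x]
    common to all intervals, the one after the [n]-th avoiding [s n], would belong to [s (D x)] and
    avoid it. *)
Lemma real_infinite_fiber (R : realType) (D : R -> nat) :
  exists d, infinite_set [set a | D a = d].
Proof.
apply: contrapT => noD.
have /choice[s sP] d : exists s : seq R, forall a, D a = d -> a \in s.
  have /finite_seqP[s Ds] : finite_set [set a | D a = d].
    by apply: contrapT => infD; apply: noD; exists d.
  by exists s => a Da; have : [set` s] a by rewrite -Ds.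
have /choice[next nextP] (u : nat * (R * R)) : exists v : R * R,
    u.2.1 < u.2.2 -> [/\ u.2.1 <= v.1, v.1 < v.2, v.2 <= u.2.2 &
      forall x, x \in s u.1 -> ~ v.1 <= x <= v.2].
  have [ab|_] := boolP (u.2.1 < u.2.2); last by exists u.2.
  by have [a [b ?]] := interval_avoiding (s u.1) ab; exists (a, b).
pose I := fix I n := if n is m.+1 then next (m, I m) else (0, 1).
have I_lt n : (I n).1 < (I n).2.
  by elim: n => [|n IH] /=; [exact: ltr01|have [] := nextP (n, I n) IH].
have I_nest n m : (n <= m)%N -> (I n).1 <= (I m).1 /\ (I m).2 <= (I n).2.
  elim: m => [|m IH]; first by rewrite leqn0 => /eqP ->.
  rewrite leq_eqVlt => /predU1P[-> //|/IH[I1 I2]].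
  have [J1 _ J2 _] := nextP (m, I m) (I_lt m).
  by split; [exact: le_trans J1|exact: le_trans J2 I2].
have I_cross n m : (I n).1 <= (I m).2.
  have [nm|/ltnW mn] := leqP n m.
    by have [] := I_nest n m nm; move=> /le_trans + _; apply; exact: ltW.
  by have [_] := I_nest m n mn; apply: le_trans; exact: ltW.
pose E := [set (I n).1 | n in setT].
have ubE m : ubound E (I m).2 by move=> _ [n _ <-].
pose x := sup E.
have [_ _ _] := nextP (D x, I (D x)) (I_lt _).
move=> /(_ x (sP _ _ erefl)); apply; apply/andP; split.
  apply: ub_le_sup; first by exists (I 0%N).2; apply: ubE.
  by exists (D x).+1.
by apply: ge_sup (ubE (D x).+1); exists (I 0%N).1, 0%N.
Qed.

(* Equivalent to K being uncountable. *)
Definition infinite_fibers (K : Type) :=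
  forall D : K -> nat, exists d, infinite_set [set a | D a = d].

Lemma complex_infinite_fibers (R : realType) : infinite_fibers R[i].
Proof.
move=> D; have [d infd] := real_infinite_fiber (D \o real_complex R).
exists d => fin; apply: infd.
apply: (@finite_preimage _ _ _ (real_complex R)) fin.
by move=> a b _ _ /complexI.
Qed.

Lemma mpoly_ring_ind (F : comNzRingType) (n : nat) (P : {mpoly F[n]} -> Prop) :
  (forall c, P c%:MP) -> (forall i, P 'X_i) ->
  (forall f g, P f -> P g -> P (f + g)) ->
  (forall f g, P f -> P g -> P (f * g)) -> forall f, P f.
Proof.
move=> PC PX PD PM; elim/mpolyind => [|c m p _ _]; first by rewrite -mpolyC0.
apply: PD; rewrite -mul_mpolyC; apply: (PM) => //.
rewrite mpolyXE_id; elim/big_ind: _ => [|f g|i _]; [by rewrite -mpolyC1|exact: PM|].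
elim: (m i) => [|e IH]; first by rewrite expr0 -mpolyC1.
by rewrite exprS; apply: PM.
Qed.

Section MaximalIdeal.
Variables (F : comNzRingType) (n : nat) (E : {mpoly F[n]} -> Prop).
Hypothesis E1 : ~ ideal_span E 1.

Lemma ideal_span_add1 (A : {mpoly F[n]} -> Prop) g f :
  ideal_span (fun p => A p \/ p = g) f ->
  exists u, ideal_span A (f - u * g).
Proof.
elim=> [|u p h [Ap|->] _ [v IH]].
- by exists 0; rewrite mul0r subr0; apply: ideal_span0.
- by exists v; rewrite -addrA; apply: ideal_spanMD.
- exists (u + v); suff -> : u * g + h - (u + v) * g = h - v * g by [].
  by rewrite mulrDl opprD addrACA subrr add0r.
Qed.

(** Zorn's lemma is applied to sets of generators added to [E] rather than to ideals; keeping [E]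
    apart takes care of the empty chain. The last clause says that the quotient ring is a field. *)
Lemma maximal_ideal : exists A : {mpoly F[n]} -> Prop,
  [/\ forall f, E f -> A f, ~ ideal_span A 1 &
      forall g, ideal_span A g \/ exists u, ideal_span A (1 - u * g)].
Proof.
pose EA (B : set {mpoly F[n]}) f := E f \/ B f.
pose P (B : set {mpoly F[n]}) := ~ ideal_span (EA B) 1.
have [F' F'P totF'|B [PB maxB]] := @Zorn_bigcup _ P.
  suff: forall f, ideal_span (EA (\bigcup_(X in F') X)) f ->
      ideal_span E f \/ exists2 X, F' X & ideal_span (EA X) f.
    by move=> spanF /spanF[/E1|[X /F'P]].
  move=> f; elim=> [|u g h [Eg|[X F'X Xg]] _ [Eh|[Y F'Y Yh]]].
  - by left; apply: ideal_span0.
  - by left; apply: ideal_spanMD.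
  - by right; exists Y => //; apply: ideal_spanMD => //; left.
  - right; exists X => //; apply: ideal_spanMD; first by right.
    by apply: ideal_span_sub Eh => p Ep; apply: ideal_span_mem; left.
  - right; have [XY|YX] := totF' X Y F'X F'Y.
      by exists Y => //; apply: ideal_spanMD => //; right; apply: XY.
    exists X => //; apply: ideal_spanMD; first by right.
    apply: ideal_span_sub Yh => p [Ep|Yp]; apply: ideal_span_mem; first by left.
    by right; apply: YX.
exists (EA B); split=> [f Ef|//|g]; first by left.
have [|ng] := pselect (ideal_span (EA B) g); first by left.
right; have /contrapT : ~ P (fun p => B p \/ p = g).
  apply: maxB; split=> [p Bp|/(_ g (or_intror erefl)) Bg]; first by left.
  by apply: ng; apply: ideal_span_mem; right.
have EA_add p : EA (fun p => B p \/ p = g) p ->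
    ideal_span (fun p => EA B p \/ p = g) p.
  by move=> [|[|]] pP; apply: ideal_span_mem; [left; left|left; right|right].
move=> /(ideal_span_sub EA_add).
exact: ideal_span_add1.
Qed.

End MaximalIdeal.

Lemma mpoly_lin_dependent (F : fieldType) (n b : nat) (I : eqType)
    (u : I -> {mpoly F[n]}) (s : seq I) :
  uniq s -> (forall i, i \in s -> msize (u i) <= b)%N ->
  (#|{: 'X_{1..n < b}}| < size s)%N ->
  exists2 c : I -> F, \sum_(i <- s) c i *: u i = 0 &
    exists2 i, i \in s & c i != 0.
Proof.
move=> us sb lt_s; have [i0 _] : exists2 i0, i0 \in s & true.
  by case: s lt_s {us sb} => // i s; exists i; rewrite // inE eqxx.
pose A := \matrix_(i < size s, j < #|{: 'X_{1..n < b}}|)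
  (u (nth i0 s i))@_(bmnm (enum_val j)).
have : kermx A != 0.
  rewrite -mxrank_eq0 mxrank_ker subn_eq0 -ltnNge.
  by apply: leq_ltn_trans (rank_leq_col _) lt_s.
move=> /rowV0Pn[c /sub_kermxP cA c_neq0].
pose c' i := if insub (index i s) is Some j then c ord0 j else 0.
have c'E (j : 'I_(size s)) : c' (nth i0 s j) = c ord0 j.
  rewrite /c' index_uniq //; case: insubP => [k _ kj|]; last by rewrite ltn_ord.
  by congr (c _ _); apply: val_inj.
exists c'.
  rewrite (big_nth i0) big_mkord; apply/mpolyP => m.
  rewrite mcoeff0 raddf_sum /=; have [mb|bm] := ltnP (mdeg m) b.
    have := congr1 (fun B : 'rV_ _ => B ord0 (enum_rank (BMultinom mb))) cA.
    rewrite !mxE; apply: etrans; apply: eq_bigr => j _.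
    by rewrite mcoeffZ c'E mxE enum_rankK.
  rewrite big1 // => j _; rewrite mcoeffZ [X in _ * X]memN_msupp_eq0 ?mulr0 //.
  by apply: msize_mdeg_ge (leq_trans _ bm); apply: sb; apply: mem_nth.
have /rV0Pn[j cj] := c_neq0.
by exists (nth i0 s j); rewrite ?mem_nth // c'E.
Qed.

(** At the point [i] only the summand [a = i] survives. *)
Lemma lagrange_neq0 (F : fieldType) (c : F -> F) (s : seq F) (i : F) :
  uniq s -> i \in s -> c i != 0 ->
  \sum_(a <- s) c a *: \prod_(b <- s | b != a) ('X - b%:P) != 0 :> {poly F}.
Proof.
move=> us si ci; apply/eqP => /(congr1 (fun p => p.[i])); apply/eqP.
rewrite horner0 horner_sum (bigD1_seq i) //=.
rewrite [X in _ + X]big1 ?addr0 => [|a ai]; last first.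
  rewrite hornerZ horner_prod; apply/eqP; rewrite mulf_eq0 prodf_seq_eq0 orbC.
  by apply/orP; left; apply/hasP; exists i => //; rewrite eq_sym ai !hornerE subrr eqxx.
rewrite hornerZ horner_prod mulf_neq0 // prodf_seq_neq0; apply/allP => b _.
by apply/implyP => bi; rewrite !hornerE subr_eq0 eq_sym.
Qed.

(* In the residue field of a maximal ideal, if x - a were invertible for all a
   then uncountably many of the inverses 1/(x - a) would be represented by
   polynomials of bounded degree; a linear relation between them makes x
   algebraic over K, hence equal to an element of K. *)
Theorem weak_nullstellensatz (K : closedFieldType) (n : nat)
    (E : {mpoly K[n]} -> Prop) : infinite_fibers K ->
  ~ ideal_span E 1 -> exists v : 'I_n -> K, forall f, E f -> f.@[v] = 0.
Proof.
move=> infK /maximal_ideal[A [EA A1 maxA]]; set M := ideal_span A in A1 maxA.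
have M_prime f g : M (f * g) -> M f \/ M g.
  move=> Mfg; have [|[u Mu]] := maxA f; [by left|right].
  have -> : g = (1 - u * f) * g + u * (f * g).
    by rewrite mulrBl mul1r mulrA subrK.
  by apply: ideal_spanD; [rewrite mulrC|]; apply: ideal_spanM.
suff /choice[v Mv] : forall i : 'I_n, exists a, M ('X_i - a%:MP).
  exists v => f /EA/ideal_span_mem Mf; apply: contrapT => /eqP fv.
  have Mfv : M (f - f.@[v]%:MP).
    move: f {Mf fv}; apply: mpoly_ring_ind => [c|i|f g Mf Mg|f g Mf Mg].
    - by rewrite mevalC subrr; apply: ideal_span0.
    - by rewrite mevalXU.
    - by rewrite mevalD mpolyCD opprD addrACA; apply: ideal_spanD.
    - rewrite mevalM mpolyCM.
      have -> : f * g - f.@[v]%:MP * g.@[v]%:MP =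
          g * (f - f.@[v]%:MP) + f.@[v]%:MP * (g - g.@[v]%:MP).
        by rewrite !mulrBr [f * g]mulrC [g * _%:MP]mulrC addrA subrK.
      by apply: ideal_spanD; apply: ideal_spanM.
  apply: A1; have -> : 1 = (f.@[v]^-1)%:MP * f.@[v]%:MP :> {mpoly K[n]}.
    by rewrite -mpolyCM mulVf.
  apply: ideal_spanM; have -> : f.@[v]%:MP = f - (f - f.@[v]%:MP).
    by rewrite opprB addrC subrK.
  exact: ideal_spanB.
move=> i; apply: contrapT => noa.
have /choice[u Mu] (a : K) : exists u, M (1 - u * ('X_i - a%:MP)).
  by have [Ma|//] := maxA ('X_i - a%:MP); case: noa; exists a.
have [d infd] := infK (fun a => msize (u a)).
have [S Sd sizeS] := infinite_set_fset #|{: 'X_{1..n < d}}|.+1 infd.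
set s := finmap.enum_fset S in sizeS.
have us : uniq s by apply: finmap.fset_uniq.
have [|c cu [j sj cj]] := @mpoly_lin_dependent _ _ d _ u s us _ sizeS.
  by move=> a sa; rewrite (Sd a).
pose q := \sum_(a <- s) c a *: \prod_(b <- s | b != a) ('X - b%:P).
have q_neq0 : q != 0 by apply: lagrange_neq0 sj cj.
pose ev (p : {poly K}) := (map_poly (@mpolyC n K) p).['X_i].
have evM : {morph ev : p p' / p * p'}.
  by move=> p p'; rewrite /ev rmorphM hornerM.
have ev_lin a : ev ('X - a%:P) = 'X_i - a%:MP.
  by rewrite /ev rmorphB /= map_polyX map_polyC !hornerE.
have ev_prod (r : seq K) (P : pred K) :
    ev (\prod_(b <- r | P b) ('X - b%:P)) = \prod_(b <- r | P b) ('X_i - b%:MP).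
  rewrite /ev rmorph_prod horner_prod; apply: eq_bigr => b _; exact: ev_lin.
have evZ a p : ev (a *: p) = a%:MP * ev p.
  by rewrite /ev map_polyZ hornerZ.
have Mq : M (ev q).
  have -> : ev q = \sum_(a <- s) (c a)%:MP *
      \prod_(b <- s | b != a) ('X_i - b%:MP).
    rewrite /ev /q rmorph_sum horner_sum; apply: eq_bigr => a _.
    by rewrite -[LHS]/(ev _) evZ ev_prod.
  (* Each summand may be multiplied by [1 - u a * ('X_i - a)], an element of [M]: the corrections
     add up to [\sum_a c a *: u a], which is zero, times the product of all ['X_i - b]. *)
  have -> : \sum_(a <- s) (c a)%:MP * \prod_(b <- s | b != a) ('X_i - b%:MP) =
     \sum_(a <- s) ((c a)%:MP * \prod_(b <- s | b != a) ('X_i - b%:MP)) *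
       (1 - u a * ('X_i - a%:MP)) :> {mpoly K[n]}.
    under [RHS]eq_bigr do rewrite mulrBr mulr1.
    rewrite sumrB [X in _ - X](_ : _ = 0) ?subr0 //.
    rewrite -[RHS](mul0r (\prod_(b <- s) ('X_i - b%:MP))) -[in RHS]cu mulr_suml.
    apply: eq_big_seq => a sa; rewrite [in RHS](bigD1_seq a) //= -mul_mpolyC.
    by rewrite -!mulrA; congr (_ * _); rewrite mulrC -mulrA.
  by apply: ideal_span_sum => a _; apply: ideal_spanM; apply: Mu.
(* Since [q] splits and [M] is prime, one linear factor ['X_i - z] lies in [M], contrary to
   [noa]. *)
have [r qr] := closed_field_poly_normal q.
have Mprod : M (\prod_(z <- r) ('X_i - z%:MP)).
  rewrite -ev_prod; have -> : ev (\prod_(z <- r) ('X - z%:P)) =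
      ((lead_coef q)^-1)%:MP * ev q.
    by rewrite [in ev q]qr -evZ scalerA mulVf ?scale1r // lead_coef_eq0.
  exact: ideal_spanM.
elim: r Mprod {qr} => [|z r IH]; first by rewrite big_nil.
by rewrite big_cons => /M_prime[Mz|//]; apply: noa; exists z.
Qed.


(** * Homogeneous polynomials *)

Lemma dhomog_mevalZ (F : comNzRingType) (n d : nat) (f : {mpoly F[n]}) t v :
  f \is d.-homog -> f.@[fun i => t * v i] = t ^+ d * f.@[v].
Proof.
move=> /dhomogP hf; rewrite !mevalE mulr_sumr; apply: eq_big_seq => m fm.
have <- : mdeg m = d := hf m fm.
rewrite mulrCA; congr (_ * _); rewrite mdegE -prodrXr -big_split.
by apply: eq_bigr => i _; rewrite exprMn.
Qed.

(** As a function of [t], the value of [f] at [t * v] is a univariate polynomial whose coefficients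
    are the values of the homogeneous components at [v]; it has infinitely many roots. *)
Lemma meval_pihomog_eq0 (F : numFieldType) (n d : nat) (f : {mpoly F[n]}) v :
  (forall t, f.@[fun i => t * v i] = 0) -> (pihomog mdeg d f).@[v] = 0.
Proof.
move=> fv; pose k := maxn (msize f) d.+1.
pose p := \poly_(e < k) (pihomog mdeg e f).@[v].
have pE t : p.[t] = 0.
  rewrite -(fv t) [in RHS](pihomog_partitionE (leq_maxl (msize f) d.+1)).
  rewrite horner_poly raddf_sum; apply: eq_bigr => e _ /=.
  by rewrite (dhomog_mevalZ _ _ (pihomogP _ _ _)) mulrC.
have p0 : p = 0.
  apply: contrapT => /eqP p_neq0.
  have /negP[] := ltnn (size p).
  rewrite -[X in (X < _)%N](size_iota 0) -(size_map (fun i => i%:R : F)).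
  apply: max_poly_roots => //; last first.
    by rewrite map_inj_uniq ?iota_uniq // => i j /eqP; rewrite eqr_nat => /eqP.
  by apply/allP => t _; apply/eqP; apply: pE.
by have := coef_poly k (fun e => (pihomog mdeg e f).@[v]) d;
  rewrite -/p p0 coef0 leq_maxr => <-.
Qed.

Lemma mcoeff_pihomog (F : nzRingType) (n d : nat) (f : {mpoly F[n]}) m :
  (pihomog mdeg d f)@_m = if mdeg m == d then f@_m else 0.
Proof.
have fm : (msize f <= maxn (msize f) (mdeg m).+1)%N := leq_maxl _ _.
have lt_m : (mdeg m < maxn (msize f) (mdeg m).+1)%N := leq_maxr _ _.
rewrite (pihomogwE _ _ fm) raddf_sum /= big_mkcond.
rewrite (bigD1 (BMultinom lt_m)) //= [X in _ + X]big1 ?addr0 => [|b bm].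
  by case: ifP => //; rewrite mcoeffZ mcoeffX eqxx mulr1.
case: ifP => // _; rewrite mcoeffZ mcoeffX (_ : _ == m = false) ?mulr0 //.
by apply: contraNF bm => /eqP bm; apply/eqP/val_inj.
Qed.

Lemma dhomogXU (F : comNzRingType) (n : nat) (i : 'I_n) :
  ('X_i : {mpoly F[n]}) \is 1.-homog.
Proof. by rewrite dhomogX; apply/eqP/mdeg1. Qed.

Lemma dhomog_mderiv (F : comNzRingType) (n d : nat) (f : {mpoly F[n]}) i :
  f \is d.-homog -> f^`M(i) \is d.-1.-homog.
Proof.
move=> /dhomogP hf; apply/dhomogP => m; rewrite mcoeff_msupp mcoeff_deriv.
move=> fm; have <- : mdeg (m + U_(i))%MM = d.
  by apply: hf; rewrite mcoeff_msupp; apply: contra_neq fm => ->; rewrite mul0rn.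
by rewrite mdegD mdeg1 addn1.
Qed.

Lemma dhomog_bigprod (F : comNzRingType) (n : nat) (I : Type) (r : seq I)
    (d : I -> nat) (f : I -> {mpoly F[n]}) :
  (forall i, f i \is (d i).-homog) ->
  \prod_(i <- r) f i \is (\sum_(i <- r) d i).-homog.
Proof.
move=> hf; elim: r => [|i r IH]; first by rewrite !big_nil dhomog1.
by rewrite !big_cons; apply: dhomogM.
Qed.

Lemma dhomog_det (F : comNzRingType) (n c : nat) (d : 'I_c -> nat)
    (A : 'M[{mpoly F[n]}]_c) :
  (forall i j, A i j \is (d i).-homog) -> \det A \is (\sum_i d i).-homog.
Proof.
move=> hA; have signC (b : bool) : (-1) ^+ b = ((-1) ^+ b)%:MP :> {mpoly F[n]}.
  by rewrite rmorphXn rmorphN rmorph1.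
apply: rpred_sum => s _; rewrite signC mul_mpolyC.
exact/dhomogZ/dhomog_bigprod.
Qed.

Lemma pihomog_ideal_span (F : fieldType) (n d : nat)
    (E : {mpoly F[n]} -> Prop) f :
  (forall g, E g -> homogeneous g) -> ideal_span E f ->
  ideal_span E (pihomog mdeg d f).
Proof.
move=> hE; elim=> [|u g h Eg _ IH]; first by rewrite pihomog0; apply: ideal_span0.
rewrite pihomogD; apply: ideal_spanD => //; have [e hg] := hE g Eg.
rewrite (pihomog_partitionE (leqnn (msize u))) mulr_suml raddf_sum /=.
apply: ideal_span_sum => i _.
have [<-|ied] := eqVneq (i + e)%N d.
  rewrite pihomog_dE; first exact/ideal_spanM/ideal_span_mem.
  exact: dhomogM (pihomogP _ _ _) hg.
suff -> : pihomog mdeg d (pihomog mdeg i u * g) = 0 by apply: ideal_span0.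
exact: pihomog_ne0 ied (dhomogM (pihomogP _ _ _) hg).
Qed.

(* A homogeneous component of [1 = f + v (x_j - 1)] says that
   [v_d = x_j v_(d-1)] modulo the ideal for d > 0, so [x_j^d = - v_d]. *)
Lemma ideal_span_homog_power (F : fieldType) (n : nat)
    (E : {mpoly F[n]} -> Prop) (j : 'I_n) :
  (forall g, E g -> homogeneous g) ->
  ideal_span (fun g => E g \/ g = 'X_j - 1) 1 ->
  exists d, ideal_span E ('X_j ^+ d).
Proof.
move=> hE /ideal_span_add1[v Ev]; pose v_ d := pihomog mdeg d v.
have hX e : v_ e * 'X_j \is (e.+1).-homog.
  by rewrite -addn1; apply: dhomogM (pihomogP _ _ _) (dhomogXU _ _).
have vX d : pihomog mdeg d.+1 (v * 'X_j) = v_ d * 'X_j.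
  rewrite [in LHS](pihomog_partitionE (leq_maxr d.+1 (msize v))).
  rewrite mulr_suml raddf_sum /= (bigD1 (Ordinal (leq_maxl d.+1 (msize v)))) //=.
  rewrite pihomog_dE ?hX // big1 ?addr0 // => e ed.
  by apply: pihomog_ne0 (hX e); apply: contra_neq ed => -[ed]; apply: val_inj.
have vX0 : pihomog mdeg 0 (v * 'X_j) = 0.
  rewrite [v](pihomog_partitionE (leqnn (msize v))) mulr_suml raddf_sum /=.
  by apply: big1 => e _; apply: pihomog_ne0 (hX e).
have E_ d := pihomog_ideal_span d hE Ev.
have power d : ideal_span E (v_ d + 'X_j ^+ d).
  elim: d => [|d IH].
    have := E_ 0%N; rewrite mulrBr mulr1 opprB addrA [1 + _]addrC pihomogB vX0 subr0.
    by rewrite pihomogD (pihomog_dE (dhomog1 _ _)).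
  have := E_ d.+1; rewrite mulrBr mulr1 opprB addrA [1 + _]addrC pihomogB vX.
  rewrite pihomogD (pihomog_ne0 (isT : (0 != d.+1)%N) (dhomog1 _ _)) addr0.
  move=> Ed; rewrite -[v_ d.+1](subrK (v_ d * 'X_j)) -addrA.
  apply: ideal_spanD => //; rewrite exprSr -mulrDl mulrC; exact: ideal_spanM.
(* In this degree [v] has no homogeneous component left. *)
exists (msize v); have := power (msize v).
rewrite /v_ [pihomog _ _ _](_ : _ = 0) ?add0r //.
rewrite pihomogE big1_seq // => m /andP[/eqP md /msize_mdeg_lt].
by rewrite md ltnn.
Qed.

(** [E] has no common zero with [j]-th coordinate 1, so the weak Nullstellensatz puts a power [d j]
    of each variable into the ideal. A monomial of degree above [\sum_j d j] is divisible by one of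
    these powers. *)
Theorem graded_nullstellensatz (K : closedFieldType) (n : nat)
    (E : {mpoly K[n]} -> Prop) : infinite_fibers K ->
  (forall g, E g -> homogeneous g) ->
  (forall v, (forall f, E f -> f.@[v] = 0) -> forall i, v i = 0) ->
  exists N, forall m, mdeg m = N -> ideal_span E 'X_[m].
Proof.
move=> infK hE E0.
have /choice[d dP] (j : 'I_n) : exists d, ideal_span E ('X_j ^+ d).
  apply: ideal_span_homog_power => //; apply: contrapT.
  move=> /(weak_nullstellensatz infK)[v Ev].
  have := Ev ('X_j - 1) (or_intror erefl).
  rewrite mevalB mevalXU meval1 E0; last by move=> f Ef; apply: Ev; left.
  by move/eqP; rewrite sub0r oppr_eq0 oner_eq0.
exists (\sum_j d j).+1 => m md.
have [j dj] : exists j, (d j <= m j)%N.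
  apply: contrapT => nod; have : (mdeg m <= \sum_j d j)%N.
    rewrite mdegE; apply: leq_sum => j _; rewrite leqNgt; apply/negP => dm.
    by apply: nod; exists j; apply: ltnW.
  by rewrite md ltnn.
have -> : m = (m - U_(j) *+ d j + U_(j) *+ d j)%MM.
  rewrite submK //; apply/mnm_lepP => i; rewrite mulmnE mnm1E.
  by case: eqP => [<-|_]; rewrite ?mul1n ?mul0n.
by rewrite mpolyXD -mpolyXn; apply: ideal_spanM.
Qed.

(** * Elimination *)

Section PolynomialFamilies.
Variables (F : comNzRingType) (N k : nat).

(** The coefficients of [h v] are polynomials in the parameter [v]; this is what makes the
    determinant in [elimination] a polynomial in [v]. *)
Definition poly_family (h : ('I_N -> F) -> {mpoly F[k]}) :=
  exists H : {mpoly {mpoly F[N]}[k]}, forall v, h v = map_mpoly (meval v) H.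

Lemma poly_family_const f : poly_family (fun=> f).
Proof.
exists (map_mpoly (@mpolyC N F) f) => v; apply/mpolyP => m.
by rewrite !mcoeff_map_mpoly /= mevalC.
Qed.

Lemma poly_family_param f : poly_family (fun v => (f.@[v])%:MP).
Proof. by exists f%:MP => v; rewrite map_mpolyC. Qed.

Lemma poly_familyD h1 h2 : poly_family h1 -> poly_family h2 ->
  poly_family (fun v => h1 v + h2 v).
Proof. by move=> [H1 e1] [H2 e2]; exists (H1 + H2) => v; rewrite rmorphD e1 e2. Qed.

Lemma poly_familyM h1 h2 : poly_family h1 -> poly_family h2 ->
  poly_family (fun v => h1 v * h2 v).
Proof. by move=> [H1 e1] [H2 e2]; exists (H1 * H2) => v; rewrite rmorphM e1 e2. Qed.

Lemma poly_family_sum (I : Type) (r : seq I) (P : pred I) h :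
  (forall i, P i -> poly_family (h i)) ->
  poly_family (fun v => \sum_(i <- r | P i) h i v).
Proof.
move=> hP; elim: r => [|i r IH].
  by have [H e] := poly_family_const 0; exists H => v; rewrite big_nil; apply: e.
have [Pi|nPi] := boolP (P i); last first.
  by have [H e] := IH; exists H => v; rewrite big_cons (negPf nPi) e.
have [H e] := poly_familyD (hP i Pi) IH.
by exists H => v; rewrite -e big_cons Pi.
Qed.

Lemma poly_family_prod (I : Type) (r : seq I) h :
  (forall i, poly_family (h i)) ->
  poly_family (fun v => \prod_(i <- r) h i v).
Proof.
move=> hP; elim: r => [|i r IH].
  by have [H e] := poly_family_const 1; exists H => v; rewrite big_nil; apply: e.
have [H e] := poly_familyM (hP i) IH.
by exists H => v; rewrite -e big_cons.
Qed.

Lemma poly_family_det (c : nat) (A : ('I_N -> F) -> 'M[{mpoly F[k]}]_c) :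
  (forall i j, poly_family (fun v => A v i j)) ->
  poly_family (fun v => \det (A v)).
Proof.
move=> hA; apply: poly_family_sum => s _; apply: poly_familyM.
  exact: poly_family_const.
exact: poly_family_prod.
Qed.

End PolynomialFamilies.

Lemma poly_family_comp (F : comNzRingType) (N k n : nat)
    (l : ('I_N -> F) -> n.-tuple {mpoly F[k]}) (f : {mpoly F[n]}) :
  (forall j, poly_family (fun v => tnth (l v) j)) ->
  poly_family (fun v => f \mPo l v).
Proof.
move=> hl; move: f; apply: mpoly_ring_ind => [c|i|f g [H e] [H' e']|f g [H e] [H' e']].
- have [H e] := poly_family_const N (c%:MP : {mpoly F[k]}).
  by exists H => v; rewrite comp_mpolyC; apply: e.
- by have [H e] := hl i; exists H => v; rewrite -e comp_mpolyXU -tnth_nth.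
- by exists (H + H') => v; rewrite comp_mpolyD rmorphD e e'.
- by exists (H * H') => v; rewrite [LHS]rmorphM [RHS]rmorphM /= e e'.
Qed.

(* By the Nullstellensatz, if the system has no nontrivial solution at v0 then
   all monomials of some degree N0 are combinations of the h a v0. Letting v vary
   in these combinations, P is the determinant of their coefficients. *)
Theorem elimination (K : numClosedFieldType) (N k : nat) (A : Type)
    (h : A -> ('I_N -> K) -> {mpoly K[k]}) (v0 : 'I_N -> K) :
  infinite_fibers K ->
  (forall a, poly_family (h a)) -> (forall a v, homogeneous (h a v)) ->
  (forall y, (forall a, (h a v0).@[y] = 0) -> forall i, y i = 0) ->
  exists2 P : {mpoly K[N]}, P.@[v0] != 0 & forall v y i,
    (forall a, (h a v).@[y] = 0) -> y i != 0 -> P.@[v] = 0.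
Proof.
move=> infK polyh hh h0; pose E g := exists a, g = h a v0.
have [N0 EX] : exists N0, forall m, mdeg m = N0 -> ideal_span E 'X_[m].
  apply: graded_nullstellensatz => // [g [a ->] //|y Ey].
  by apply: h0 => a; apply: Ey; exists a.
have span_family g : ideal_span E g -> exists2 H : {mpoly {mpoly K[N]}[k]},
    map_mpoly (meval v0) H = g & forall v y, (forall a, (h a v).@[y] = 0) ->
    (map_mpoly (meval v) H).@[y] = 0.
  elim=> [|u _ q [a ->] _ [H eH H0]].
    by exists 0 => [|v y _]; rewrite rmorph0 ?meval0.
  have [H1 e1] := poly_familyM (poly_family_const N u) (polyh a).
  exists (H1 + H) => [|v y hy]; first by rewrite rmorphD /= -e1 eH.
  by rewrite rmorphD /= mevalD -e1 mevalM hy mulr0 add0r H0.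
pose T := {m : 'X_{1..k < N0.+1} | mdeg m == N0}.
have Tdeg (m : T) : mdeg (val (val m)) = N0 by apply/eqP; exact: (valP m).
have /choice[H HP] : forall m : T, exists H : {mpoly {mpoly K[N]}[k]},
    map_mpoly (meval v0) H = 'X_[val (val m)] /\
    forall v y, (forall a, (h a v).@[y] = 0) -> (map_mpoly (meval v) H).@[y] = 0.
  by move=> m; have [H] := span_family _ (EX _ (Tdeg m)); exists H.
pose M := \matrix_(i < #|{: T}|, j < #|{: T}|)
  (H (enum_val i))@_(val (val (enum_val j))).
have ME v : (\det M).@[v] =
    \det (\matrix_(i < #|{: T}|, j < #|{: T}|) (map_mpoly (meval v) (H (enum_val i)))@_
      (val (val (enum_val j)))).
  transitivity (\det (map_mx (meval v) M)); first by rewrite det_map_mx.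
  by congr (\det _); apply/matrixP => i j; rewrite !mxE mcoeff_map_mpoly.
exists (\det M) => [|v y i hy yi].
  rewrite ME (_ : \matrix_(_, _) _ = 1%:M) ?det1 ?oner_eq0 //.
  apply/matrixP => i j; rewrite !mxE; have [-> _] := HP (enum_val i).
  by rewrite mcoeffX (inj_eq val_inj) (inj_eq val_inj) (inj_eq enum_val_inj).
rewrite ME; set Mv := (\matrix_(_, _) _); apply: contrapT => /eqP det0.
have Mu : Mv \in unitmx by rewrite unitmxE unitfE.
have yN0 : mdeg (U_(i) *+ N0)%MM = N0 by rewrite mdegMn mdeg1 mul1n.
have yN0_lt : (mdeg (U_(i) *+ N0)%MM < N0.+1)%N by rewrite yN0.
have yT : mdeg (BMultinom yN0_lt) == N0 by apply/eqP.
(* The monomials of degree [N0] at [y]. The matrix [Mv] annihilates this vector, whose entry for the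
   [N0]-th power of the variable [i] is nonzero. *)
pose w := \col_(j < #|{: T}|) ('X_[K, val (val (enum_val j))]).@[y].
have w0 : w = 0.
  rewrite -[w]mul1mx -(mulVmx Mu) -mulmxA [X in _ *m X](_ : _ = 0) ?mulmx0 //.
  apply/colP => a; rewrite !mxE; set q := map_mpoly (meval v) (H (enum_val a)).
  (* The polynomial [q] need not be homogeneous, but all multiples [t * y] solve the system as well,
     so its component of degree [N0] vanishes at [y]. *)
  have qN0 : (pihomog mdeg N0 q).@[y] = 0.
    apply: meval_pihomog_eq0 => t; have [_ H0] := HP (enum_val a).
    apply: H0 => b; have [d hd] := hh b v.
    by rewrite (dhomog_mevalZ _ _ hd) hy mulr0.
  have q_le : (msize (pihomog mdeg N0 q) <= N0.+1)%N.
    rewrite msizeE; apply/bigmax_leqP_seq => m + _; rewrite mcoeff_msupp.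
    by rewrite mcoeff_pihomog; case: ifP => [/eqP ->|_] //; rewrite eqxx.
  rewrite -[RHS]qN0 [in RHS](mpolywE q_le) raddf_sum /=.
  transitivity (\sum_(m in {: T}) q@_(val (val m)) * ('X_[K, val (val m)]).@[y]).
    by rewrite [RHS]big_enum_val; apply: eq_bigr => j _; rewrite !mxE.
  rewrite [RHS](bigID [pred m : 'X_{1..k < N0.+1} | mdeg m == N0]) /=.
  rewrite [X in _ + X]big1 ?addr0 => [|m /negPf mN0]; last first.
    by rewrite mevalZ mcoeff_pihomog mN0 mul0r.
  rewrite [RHS](eq_bigr (fun m : 'X_{1..k < N0.+1} => q@_m * ('X_[K, m]).@[y])).
    by rewrite [RHS](@big_sub _ _ _ _ [pred m : 'X_{1..k < N0.+1} | mdeg m == N0]).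
  by move=> m /eqP mN0; rewrite mevalZ mcoeff_pihomog mN0 eqxx.
have := congr1 (fun B : 'cV_ _ => B (enum_rank (Sub (BMultinom yN0_lt) yT : T)) ord0) w0.
rewrite !mxE enum_rankK SubK /= -mpolyXn rmorphXn /= mevalXU => /eqP.
by rewrite expf_eq0 (negPf yi) andbF.
Qed.


(** * Points, gradients and tangent spaces *)

Section Cone.
Variables (F : fieldType) (n : nat).
Implicit Types (X : set (Gr F 1 n)) (p : Gr F 1 n) (x v : 'rV[F]_n).
Implicit Types f g : {mpoly F[n]}.

Lemma Gr1_mx_neq0 p : Gr_mx p != 0.
Proof. by have := Gr_mx_free p; rewrite /row_free rank_rV eqb1. Qed.

Lemma rV_free x : x != 0 -> row_free x.
Proof. by rewrite /row_free rank_rV => ->. Qed.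

Lemma Gr1_mx_scale p x : x != 0 -> (x <= Gr_mx p)%MS ->
  exists2 t, t != 0 & x = t *: Gr_mx p.
Proof.
move=> x0 /submxP[D xD]; exists (D 0 0).
  by apply: contra_neq x0 => D0; rewrite xD [D]mx11_scalar D0 mul_scalar_mx scale0r.
by rewrite xD [D in LHS]mx11_scalar mul_scalar_mx.
Qed.

Definition vanishing X f := homogeneous f /\ forall q, X q -> f.@[pcoord q] = 0.

Lemma homogeneous_meval0 f p x : homogeneous f -> x != 0 ->
  (x <= Gr_mx p)%MS -> (f.@[x ord0] = 0) <-> (f.@[pcoord p] = 0).
Proof.
move=> [d hf] x0 /(Gr1_mx_scale x0)[t t0 xt].
have -> : f.@[x ord0] = t ^+ d * f.@[pcoord p].
  rewrite -(dhomog_mevalZ _ _ hf); apply: meval_eq => i.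
  by rewrite xt mxE.
split=> [/eqP|->]; last by rewrite mulr0.
by rewrite mulf_eq0 expf_eq0 (negPf t0) andbF => /eqP.
Qed.

Lemma zariski_closedP X p x : zariski_closed (@pcoord F n) X -> x != 0 ->
  (x <= Gr_mx p)%MS -> X p <-> forall f, vanishing X f -> f.@[x ord0] = 0.
Proof.
move=> [E hE XE] x0 xp; split=> [Xp f [hf fX]|fx].
  by apply/(homogeneous_meval0 hf x0 xp); apply: fX.
rewrite XE => f Ef; apply/(homogeneous_meval0 (hE f Ef) x0 xp); apply: fx.
by split; [exact: hE|move=> q; rewrite XE; apply].
Qed.

Definition gradient f x : 'rV[F]_n := \row_j (f^`M(j)).@[x ord0].

Lemma gradientZ f d t x : f \is d.-homog ->
  gradient f (t *: x) = t ^+ d.-1 *: gradient f x.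
Proof.
move=> hf; apply/rowP => j; rewrite !mxE.
rewrite -(dhomog_mevalZ _ _ (dhomog_mderiv j hf)).
by apply: meval_eq => i; rewrite mxE.
Qed.

Lemma mulmx_trE (u v : 'rV[F]_n) : (u *m v^T == 0) = (\sum_j u 0 j * v 0 j == 0).
Proof.
rewrite [u *m v^T]mx11_scalar -scalemx1 scalemx_eq0 oner_eq0 orbF mxE.
by under eq_bigr do rewrite mxE.
Qed.

Lemma tangent_space_gradient X p x v : x != 0 -> (x <= Gr_mx p)%MS ->
  (v <= tangent_space X p)%MS <->
  forall f, vanishing X f -> gradient f x *m v^T = 0.
Proof.
move=> x0 /(Gr1_mx_scale x0)[t t0 xt].
have grad_eq0 f : homogeneous f -> (gradient f x *m v^T == 0) =
    (\sum_(j < n) (f^`M(j)).@[pcoord p] * v ord0 j == 0).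
  move=> [d hf]; rewrite xt (gradientZ _ _ hf) -scalemxAl scalemx_eq0.
  rewrite expf_eq0 (negPf t0) andbF mulmx_trE.
  by under eq_bigr do rewrite mxE.
split=> [/tangent_spaceP Tv f [hf fX]|Tv].
  by apply/eqP; rewrite grad_eq0 //; apply/eqP; apply: Tv.
apply/tangent_spaceP => f hf fX; apply/eqP; rewrite -grad_eq0 //.
by apply/eqP; apply: Tv.
Qed.

End Cone.

(** * Complements of a subspace given by linear equations *)

Section Annihilator.
Variable F : fieldType.

(** A free family of maximal size. Its rows belong to [Phi] and not merely to its span: for
    gradients of homogeneous equations, of possibly different degrees, a combination need not come
    from a homogeneous equation. *)
Lemma spanning_family (n : nat) (Phi : set 'rV[F]_n) :
  exists r (B : 'M[F]_(r, n)), [/\ row_free B, forall i, Phi (row i B) &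
    forall v, Phi v -> (v <= B)%MS].
Proof.
pose P r := `[< exists B : 'M[F]_(r, n), row_free B /\
  forall i, Phi (row i B) >].
have exP : exists r, P r.
  exists 0%N; apply/asboolP; exists 0; split; last by case.
  by rewrite /row_free mxrank0.
have ubP r : P r -> (r <= n)%N.
  by move=> /asboolP[B [/eqP rB _]]; rewrite -rB rank_leq_col.
case: (ex_maxnP exP ubP) => r /asboolP[B [freeB PhiB]] maxr.
exists r, B; split=> // v Phiv; apply: contrapT => /negP vB.
suff : P (r + 1)%N by move=> /maxr; rewrite addn1 ltnn.
apply/asboolP; exists (col_mx B v); split=> [|i]; last first.
  case: (split_ordP i) => j ->; first by rewrite rowKu.
  by rewrite rowKd (_ : row j v = v) //; apply/rowP => l; rewrite mxE ord1.
have v0 : v != 0 by apply: contraNneq vB => ->; rewrite sub0mx.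
rewrite /row_free -addsmxE; have cap0 : \rank (B :&: v)%MS = 0%N.
  apply/eqP; rewrite mxrank_eq0 -submx0; apply/rV_subP => u.
  rewrite sub_capmx => /andP[uB /submxP[D uD]]; rewrite submx0.
  rewrite uD [D]mx11_scalar mul_scalar_mx scalemx_eq0 (negPf v0) orbF.
  apply: contraNT vB => D0; rewrite -(eqmx_scale v D0) -mul_scalar_mx.
  by rewrite -mx11_scalar -uD.
by have := mxrank_sum_cap B v; rewrite cap0 addn0 (eqP freeB) rank_rV v0 => ->.
Qed.

Variables (c d : nat) (Phi : set 'rV[F]_(c + d)) (T : 'M[F]_(c + d)).
Hypothesis T_ann :
  forall v : 'rV_(c + d), (v <= T)%MS <-> forall u, Phi u -> u *m v^T = 0.
Hypothesis T_rank : \rank T = d.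

(** A vector [a *m W] of [T] satisfies [B *m W^T *m a^T = 0], so [W] meets [T] trivially; the ranks
    [c] and [d] then fill the space. *)
Lemma annihilator_det_neq0 (W B : 'M[F]_(c, c + d)) :
  (forall i, Phi (row i B)) -> \det (B *m W^T) != 0 -> row_full (W + T)%MS.
Proof.
move=> PhiB det0; have unitBW : B *m W^T \in unitmx by rewrite unitmxE unitfE.
have cap0 : \rank (W :&: T)%MS = 0%N.
  apply/eqP; rewrite mxrank_eq0 -submx0; apply/rV_subP => u.
  rewrite sub_capmx => /andP[/submxP[a ->] /T_ann Ta]; rewrite submx0.
  suff -> : a = 0 by rewrite mul0mx.
  apply: trmx_inj; rewrite -[a^T]mul1mx -(mulVmx unitBW) trmx0 -!mulmxA.
  rewrite [X in _ *m X](_ : _ = 0) ?mulmx0 // -trmx_mul.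
  apply/row_matrixP => i; rewrite row_mul row0; apply: Ta; exact: PhiB.
have W_rank : \rank W = c.
  apply/eqP; rewrite eqn_leq rank_leq_row /=.
  have := mxrankM_maxr B W^T.
  by rewrite mxrank_tr mxrank_unit.
by rewrite /row_full -[\rank _]addn0 -cap0 mxrank_sum_cap W_rank T_rank.
Qed.

Lemma annihilator_basis : exists2 B : 'M[F]_(c, c + d),
  (forall i, Phi (row i B)) &
  forall v : 'rV_(c + d), (v <= T)%MS = (B *m v^T == 0).
Proof.
have [r [B [freeB PhiB spanB]]] := spanning_family Phi.
have TB (v : 'rV_(c + d)) : (v <= T)%MS = (B *m v^T == 0).
  apply/idP/eqP => [/T_ann Tv|Bv].
    by apply/row_matrixP => i; rewrite row_mul row0; apply: Tv; exact: PhiB.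
  apply/T_ann => u /spanB/submxP[D ->].
  by rewrite -mulmxA Bv mulmx0.
suff rc : c = r by case: r / rc B {freeB spanB} PhiB TB => B PhiB TB; exists B.
have : (T == kermx B^T)%MS.
  apply/andP; split; apply/rV_subP => v.
    rewrite TB => /eqP Bv; apply/sub_kermxP.
    by rewrite -[v]trmxK -trmx_mul Bv trmx0.
  by move=> /sub_kermxP vB; rewrite TB -[B]trmxK -trmx_mul vB trmx0.
move=> eqTB; have := eqmx_rank eqTB; rewrite T_rank mxrank_ker mxrank_tr.
rewrite (eqP freeB) => dE.
have rle : (r <= c + d)%N by rewrite -(eqP freeB) rank_leq_col.
by apply/eqP; rewrite -(eqn_add2r d) [X in (r + X)%N]dE subnKC.
Qed.

(** For a basis [B] of equations of [T], multiplication by [B^T] kills [T], so [L *m B^T] inherits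
    the full rank [c] of [B^T]; [e] selects [c] independent rows. *)
Lemma annihilator_det_exists (k : nat) (L : 'M[F]_(k, c + d)) :
  row_full (L + T)%MS -> exists2 B : 'M[F]_(c, c + d),
  (forall i, Phi (row i B)) &
  exists e : 'I_c -> 'I_k, \det (B *m (rowsub e L)^T) != 0.
Proof.
move=> LT_full; have [B PhiB TB] := annihilator_basis.
exists B => //.
have TB0 : T *m B^T = 0.
  apply/row_matrixP => i; rewrite row_mul row0; apply: trmx_inj.
  by rewrite trmx_mul trmxK trmx0; apply/eqP; rewrite -TB row_sub.
have B_rank : \rank B = c.
  have : (kermx B^T <= T)%MS.
    apply/rV_subP => v /sub_kermxP vB.
    by rewrite TB -[B]trmxK -trmx_mul vB trmx0.
  move=> /mxrankS; rewrite mxrank_ker T_rank mxrank_tr leq_subLR.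
  rewrite leq_add2r => cB; apply/eqP; rewrite eqn_leq cB.
  by rewrite rank_leq_row.
have full_LB : row_full (L *m B^T).
  rewrite /row_full eqn_leq rank_leq_col /= -{1}B_rank -(mxrank_tr B).
  apply: mxrankS; rewrite -[X in (X <= _)%MS]mul1mx.
  apply: submx_trans (submxMr _ (submx_full _ LT_full)) _.
  by rewrite addsmxMr TB0 addsmx0.
exists (fullrankfun full_LB); rewrite -unitfE -unitmxE.
rewrite -unitmx_tr trmx_mul trmxK mul_rowsub_mx.
exact: fullrowsub_unit.
Qed.

End Annihilator.


(** * Higher Chow loci *)

Lemma increasing_rearrangement (k n : nat) (g : 'I_k -> 'I_n) : injective g ->
  exists2 s : {ffun 'I_k -> 'I_n}, s \in increasing k n &
  exists sigma : 'S_k, forall i, g i = s (sigma i).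
Proof.
move=> g_inj; pose leo (a b : 'I_n) := (a <= b)%N.
pose l := sort leo (codom g).
have l_size : size l = k by rewrite size_sort size_codom card_ord.
have l_uniq : uniq l by rewrite sort_uniq; apply/injectiveP.
have l_mem i : g i \in l by rewrite mem_sort codom_f.
have lt_index i : (index (g i) l < k)%N by rewrite -[X in (_ < X)%N]l_size index_mem.
have sigma_inj : injective (fun i => Ordinal (lt_index i)).
  move=> i j [] /(congr1 (nth (g i) l)); rewrite !nth_index //.
  exact: g_inj.
exists [ffun i => nth (g i) l i]; last first.
  exists (perm sigma_inj) => i; rewrite permE ffunE /=.
  by rewrite nth_index.
rewrite inE; apply/forallP => i; apply/forallP => j; apply/implyP => ij.
rewrite !ffunE (set_nth_default (g i)) ?l_size //.
have leo_trans : transitive leo by move=> a b e; apply: leq_trans.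
have l_sorted : sorted leo l by apply: sort_sorted => a b; apply: leq_total.
have := sorted_ltn_nth leo_trans (g i) l_sorted; rewrite /leo => mono.
have := mono i j; rewrite !inE l_size !ltn_ord => /(_ isT isT ij).
rewrite [in X in X -> _]leq_eqVlt => /predU1P[/val_inj/eqP|//].
by rewrite nth_uniq ?l_size // => /eqP eq_ij; rewrite eq_ij ltnn in ij.
Qed.

(** Up to the sign of the sorting permutation the minor is a Pluecker coordinate, and it is zero if
    [g] repeats a column. Such unsorted [g] arise from [replace_col]. *)
Lemma plucker_colsub (F : fieldType) (k n : nat) (g : 'I_k -> 'I_n) :
  exists2 H : {mpoly F[#|increasing k n|]}, H \is 1.-homog &
    forall L : Gr F k n, H.@[plucker L] = \det (colsub g (Gr_mx L)).
Proof.
have [/injectiveP g_inj|/injectivePn[i [j ij gij]]] := boolP (injectiveb g).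
  have [s inc_s [sigma gE]] := increasing_rearrangement g_inj.
  exists ((-1) ^+ sigma *: 'X_(enum_rank_in inc_s s)).
    by apply/dhomogZ/dhomogXU.
  move=> L; rewrite mevalZ mevalXU /plucker enum_rankK_in //.
  have -> : colsub g (Gr_mx L) = col_perm sigma (colsub s (Gr_mx L)).
    by apply/matrixP => a b; rewrite !mxE gE.
  by rewrite col_permE det_mulmx det_perm odd_permV mulrC.
exists 0; first exact: dhomog0.
move=> L; rewrite meval0 -det_tr; apply/esym/(determinant_alternate ij) => a.
by rewrite !mxE gij.
Qed.

Section Chart.
Variables (F : fieldType) (k n : nat) (g : 'I_k -> 'I_n).

Definition replace_col (i : 'I_k) (j : 'I_n) : 'I_k -> 'I_n :=
  fun l => if l == i then j else g l.

(** Cramer's rule, by expansion along the replaced column. *)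
Lemma adj_colsub_mul (A : 'M[F]_(k, n)) i j :
  (\adj (colsub g A) *m A) i j = \det (colsub (replace_col i j) A).
Proof.
rewrite (expand_det_col _ i) !mxE; apply: eq_bigr => a _.
rewrite mulrC !mxE /replace_col eqxx; congr (_ * (_ * _)).
congr (\det _); apply/matrixP => u v; rewrite !mxE.
by rewrite eq_sym (negPf (neq_lift _ _)).
Qed.

(** Where the minor at [g] is nonzero, the adjugate of that block times the frame is a frame of the
    same subspace with entries linear in the Pluecker coordinates. The scalar [t] serves to extract
    homogeneous components later. *)
Lemma plucker_chart : exists (G : {mpoly F[#|increasing k n|]})
    (H : 'I_k -> 'I_n -> {mpoly F[#|increasing k n|]}),
  [/\ G \is 1.-homog, forall i j, H i j \is 1.-homog &
  forall L : Gr F k n, G.@[plucker L] = \det (colsub g (Gr_mx L)) /\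
    forall t, t != 0 -> G.@[plucker L] != 0 ->
    ((\matrix_(i, j) (H i j).@[fun s => t * plucker L s])%R == Gr_mx L)%MS].
Proof.
have [G homG GE] := plucker_colsub F g.
have /choice[H HP] (ij : 'I_k * 'I_n) : exists H : {mpoly F[#|increasing k n|]},
    H \is 1.-homog /\ forall L : Gr F k n,
    H.@[plucker L] = \det (colsub (replace_col ij.1 ij.2) (Gr_mx L)).
  by have [H homH HE] := plucker_colsub F (replace_col ij.1 ij.2); exists H.
exists G, (fun i j => H (i, j)); split=> // [i j|L]; first by have [] := HP (i, j).
split=> // t t0; rewrite GE => det0.
have -> : \matrix_(i, j) (H (i, j)).@[fun s => t * plucker L s] =
    t *: \adj (colsub g (Gr_mx L)) *m Gr_mx L.
  apply/matrixP => i j; have [homH HE] := HP (i, j).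
  by rewrite -scalemxAl !mxE (dhomog_mevalZ _ _ homH) expr1 HE -adj_colsub_mul mxE.
have adj_unit : t *: \adj (colsub g (Gr_mx L)) \in unitmx.
  have : (t *: \adj (colsub g (Gr_mx L))) *m colsub g (Gr_mx L) \in unitmx.
    rewrite -scalemxAl mul_adj_mx scale_scalar_mx unitmxE det_scalar unitfE.
    by rewrite expf_neq0 ?mulf_neq0.
  by rewrite unitmx_mul => /andP[].
by apply/eqmxP/eqmxMfull; rewrite row_full_unit.
Qed.

End Chart.


Lemma dhomog_sum (F : comNzRingType) (n d : nat) (I : Type) (r : seq I)
    (P : pred I) (f : I -> {mpoly F[n]}) :
  (forall i, P i -> f i \is d.-homog) -> \sum_(i <- r | P i) f i \is d.-homog.
Proof. exact: rpred_sum. Qed.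

Lemma dhomog_comp (F : comNzRingType) (n k d : nat) (f : {mpoly F[n]})
    (l : n.-tuple {mpoly F[k]}) :
  f \is d.-homog -> (forall j, tnth l j \is 1.-homog) -> f \mPo l \is d.-homog.
Proof.
move=> /dhomogP hf hl; rewrite comp_mpolyE big_seq; apply: dhomog_sum => m fm.
have <- : mdeg m = d by apply: hf.
rewrite mdegE; apply/dhomogZ/dhomog_bigprod => j.
by rewrite -[X in X.-homog]mul1n; apply: dhomogMn.
Qed.

Lemma dhomog_MC (F : comNzRingType) (n d : nat) (h : {mpoly F[n]}) (a : F) :
  h \is d.-homog -> h * a%:MP \is d.-homog.
Proof. by move=> hd; rewrite mulrC mul_mpolyC; apply: dhomogZ. Qed.

Section LinearForms.
Variables (F : fieldType) (k n : nat).
Implicit Type A : 'M[F]_(k, n).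

(** Substituting these forms restricts a polynomial to the row space of [A], in the coordinates [y]
    of the point [y *m A]. *)
Definition linear_forms A : n.-tuple {mpoly F[k]} :=
  [tuple \sum_i 'X_i * (A i j)%:MP | j < n].

Lemma meval_linear_forms A (f : {mpoly F[n]}) (y : 'rV[F]_k) :
  (f \mPo linear_forms A).@[y ord0] = f.@[(y *m A) ord0].
Proof.
rewrite comp_mpoly_meval; apply: meval_eq => j.
rewrite tnth_mktuple raddf_sum /= mxE; apply: eq_bigr => i _.
by rewrite mevalM mevalXU mevalC.
Qed.

Lemma dhomog_linear_form A j : tnth (linear_forms A) j \is 1.-homog.
Proof.
by rewrite tnth_mktuple; apply: dhomog_sum => i _; apply/dhomog_MC/dhomogXU.
Qed.

End LinearForms.

(** * Zariski openness of transversality *)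

Section Separation.
Variables (K : numClosedFieldType) (c e k : nat) (X : set (Gr K 1 (c + e))).
Hypothesis infK : infinite_fibers K.
Hypothesis closedX : zariski_closed (@pcoord K (c + e)) X.
Hypothesis rankX : forall p, X p -> \rank (tangent_space X p) = e.
Variable L0 : Gr K k (c + e).
Hypothesis trL0 : transverse L0 X.

Let gradients x := [set gradient f x | f in vanishing X].

Lemma tangent_gradients p (x v : 'rV[K]_(c + e)) : x != 0 -> (x <= Gr_mx p)%MS ->
  (v <= tangent_space X p)%MS <-> forall u, gradients x u -> u *m v^T = 0.
Proof.
move=> x0 xp; rewrite (tangent_space_gradient X v x0 xp).
by split=> [Tv _ [f fX <-]|Tv f fX]; apply: Tv => //; exists f.
Qed.

Section Families.
Variables (N : nat) (H : 'I_k -> 'I_(c + e) -> {mpoly K[N]}).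

Let AA v := \matrix_(i < k, j < c + e) (H i j).@[v].

Let index := ({f : {mpoly K[c + e]} | vanishing X f} +
  ({f : 'I_c -> {mpoly K[c + e]} | forall a, vanishing X (f a)} *
     ('I_c -> 'I_k)))%type.

(** For [x = y *m AA v], the equations [inl] put [x] on [X]. The equations [inr] pair the
    differentials at [x] of [c] equations of [X] with [c] rows of [AA v]; all these determinants
    vanish exactly when the row space and the tangent space fail to span. *)
Let equation (a : index) v : {mpoly K[k]} :=
  match a with
  | inl f => sval f \mPo linear_forms (AA v)
  | inr (f, s) => \det (\matrix_(a, b)
      \sum_j ((sval f a)^`M(j) \mPo linear_forms (AA v)) * ((H (s b) j).@[v])%:MP)
  end.

Lemma equation_family a : poly_family (equation a).
Proof.
have forms_family j : poly_family (fun v => tnth (linear_forms (AA v)) j).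
  have [h hE] : poly_family (fun v => \sum_i 'X_i * ((H i j).@[v])%:MP).
    apply: poly_family_sum => i _; apply: poly_familyM.
      exact: poly_family_const.
    exact: poly_family_param.
  exists h => v; rewrite tnth_mktuple -hE.
  by apply: eq_bigr => i _; rewrite mxE.
case: a => [f|[f s]]; first exact: poly_family_comp.
apply: poly_family_det => i j.
suff [h hE] : poly_family (fun v => \sum_l
    ((sval f i)^`M(l) \mPo linear_forms (AA v)) * ((H (s j) l).@[v])%:MP).
  by exists h => v; rewrite mxE hE.
apply: poly_family_sum => l _; apply: poly_familyM; first exact: poly_family_comp.
exact: poly_family_param.
Qed.

Lemma equation_homogeneous a v : homogeneous (equation a v).
Proof.
have homog_comp d (f : {mpoly K[c + e]}) :
    f \is d.-homog -> f \mPo linear_forms (AA v) \is d.-homog.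
  by move=> hf; apply: dhomog_comp => // j; apply: dhomog_linear_form.
case: a => [[f [[d hf] fX]]|[[f fX] s]] /=; first by exists d; apply: homog_comp.
have /choice[d hd] (a : 'I_c) : exists d, f a \is d.-homog by have [] := fX a.
exists (\sum_a (d a).-1)%N; apply: dhomog_det => a b; rewrite mxE.
by apply: dhomog_sum => j _; apply/dhomog_MC/homog_comp/dhomog_mderiv.
Qed.

Lemma equation_inl f v (y : 'rV[K]_k) :
  (equation (inl f) v).@[y ord0] = (sval f).@[(y *m AA v) ord0].
Proof. exact: meval_linear_forms. Qed.

Lemma equation_inr f s v (y : 'rV[K]_k) : (equation (inr (f, s)) v).@[y ord0] =
  \det ((\matrix_a gradient (sval f a) (y *m AA v)) *m (rowsub s (AA v))^T).
Proof.
rewrite /= -[LHS]det_map_mx; congr (\det _); apply/matrixP => a b.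
rewrite !mxE raddf_sum /=; apply: eq_bigr => j _.
by rewrite !mxE mevalM mevalC meval_linear_forms.
Qed.

(** A nonzero determinant at a common point exhibits rows of [L] complementary to the tangent space;
    conversely, transversality at that point provides a nonzero determinant. *)
Lemma equations_solvable (L : Gr K k (c + e)) v : (AA v == Gr_mx L)%MS ->
  ~ transverse L X <->
  exists2 y : 'rV[K]_k, (forall a, (equation a v).@[y ord0] = 0) & y != 0.
Proof.
move=> /eqmxP AL; split=> [|[y y0 yn0] trL].
  move=> /existsNP[p /not_implyP[Lp /not_implyP[Xp nfull]]].
  have [D pD] : exists D, Gr_mx p = D *m AA v.
    by apply/submxP; rewrite (submx_trans Lp) // AL.
  exists D; last first.
    by apply: contra_neq (Gr1_mx_neq0 p) => D0; rewrite pD D0 mul0mx.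
  move=> [f|[f s]].
    by rewrite equation_inl -pD; have [_ ->] := svalP f.
  rewrite equation_inr -pD; apply: contrapT => /eqP det0; apply: nfull.
  have Wfull := @annihilator_det_neq0 _ _ _ _ _
    (fun v => tangent_gradients v (Gr1_mx_neq0 p) (submx_refl _)) (rankX Xp)
    _ _ _ det0.
  have : row_full (rowsub s (AA v) + tangent_space X p)%MS.
    by apply: Wfull => a; rewrite rowK; exists (sval f a) => //; apply: (svalP f).
  apply: contraTT => nfull; apply: contra nfull => Wf.
  rewrite -sub1mx (submx_trans (submx_full _ Wf)) // addsmxS //.
  by rewrite -AL rowsub_sub.
set x := y *m AA v.
have AA_free : row_free (AA v).
  by rewrite /row_free AL; apply: Gr_mx_free.
have x0 : x != 0.
  apply: contraNneq yn0 => xE; apply/eqP.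
  by apply: (row_free_inj AA_free); rewrite mul0mx.
pose p := Gr_span (rV_free x0).
have xp : (x <= Gr_mx p)%MS by rewrite Gr_spanK.
have Xp : X p.
  apply/(zariski_closedP closedX x0 xp) => f fX.
  by have := y0 (inl (exist _ f fX)); rewrite equation_inl.
have Lp : points L p by rewrite /points /= Gr_spanK -AL submxMl.
have full : row_full (AA v + tangent_space X p)%MS.
  by rewrite -sub1mx (submx_trans (submx_full _ (trL p Lp Xp))) // addsmxS // AL.
have [B PhiB [s]] := annihilator_det_exists
  (fun v => tangent_gradients v x0 xp) (rankX Xp) full.
have /choice[f fB] (a : 'I_c) : exists f, vanishing X f /\ gradient f x = row a B.
  by have [f fX fB] := PhiB a; exists f.
have fX a : vanishing X (f a) by have [] := fB a.
have := y0 (inr (exist _ f fX, s)); rewrite equation_inr => det0.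
have -> : B = \matrix_a gradient (f a) x.
  by apply/row_matrixP => a; rewrite rowK; have [] := fB a.
by rewrite det0 eqxx.
Qed.

Lemma equations_elimination v0 : (AA v0 == Gr_mx L0)%MS ->
  exists2 P : {mpoly K[N]}, P.@[v0] != 0 &
    forall (L : Gr K k (c + e)) v, (AA v == Gr_mx L)%MS ->
    ~ transverse L X -> P.@[v] = 0.
Proof.
move=> AL0; have rowE (y : 'I_k -> K) f : f.@[(\row_i y i) ord0] = f.@[y].
  by apply: meval_eq => i; rewrite mxE.
have [y y0 i|P Pv0 P0] :=
  elimination (v0 := v0) infK equation_family equation_homogeneous.
  apply: contrapT => /eqP yi; suff : ~ transverse L0 X by apply.
  apply/(equations_solvable AL0); exists (\row_i y i) => [a|].
    by rewrite rowE.
  by apply/rV0Pn; exists i; rewrite mxE.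
exists P => // L v AL /(equations_solvable AL)[y y0 /rV0Pn[i yi]].
exact: P0 y0 yi.
Qed.

End Families.

(** The polynomial [P] from elimination controls only subspaces in the chart around [L0]; the factor
    [G] vanishes outside it. The product [G * P] vanishes on all multiples of the coordinates of a
    non-transverse [L], hence so do its homogeneous components, one of which is nonzero at [L0]. *)
Theorem transverse_separation :
  exists2 f : {mpoly K[#|increasing k (c + e)|]},
    homogeneous f /\ f.@[plucker L0] != 0 &
    forall L : Gr K k (c + e), ~ transverse L X -> f.@[plucker L] = 0.
Proof.
have full : row_full (Gr_mx L0)^T.
  by rewrite /row_full mxrank_tr; apply: Gr_mx_free.
have [G [H [homG homH chart]]] := plucker_chart K (fullrankfun full).
have GL0 : G.@[plucker L0] != 0.
  have [-> _] := chart L0; rewrite -unitfE -unitmxE -unitmx_tr.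
  suff -> : (colsub (fullrankfun full) (Gr_mx L0))^T =
      rowsub (fullrankfun full) (Gr_mx L0)^T by exact: fullrowsub_unit.
  by apply/matrixP => i j; rewrite !mxE.
have AL0 : ((\matrix_(i, j) (H i j).@[plucker L0])%R == Gr_mx L0)%MS.
  have [_ /(_ 1 (oner_neq0 _) GL0)] := chart L0.
  suff -> : \matrix_(i, j) (H i j).@[fun s => 1 * plucker L0 s] =
      \matrix_(i, j) (H i j).@[plucker L0] by [].
  apply/matrixP => i j; rewrite !mxE; apply: meval_eq => s; exact: mul1r.
have [P PL0 P0] := equations_elimination AL0.
have GP0 : (G * P).@[plucker L0] != 0 by rewrite mevalM mulf_neq0.
have [d dP] : exists d, (pihomog mdeg d (G * P)).@[plucker L0] != 0.
  apply: contrapT => nod; move: GP0.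
  rewrite (pihomog_partitionE (leqnn (msize (G * P)))) raddf_sum /=.
  rewrite big1 ?eqxx // => d _; apply: contrapT => /eqP ne0.
  by apply: nod; exists d.
exists (pihomog mdeg d (G * P)).
  by split=> //; exists d; apply: pihomogP.
move=> L ntL; apply: meval_pihomog_eq0 => t; rewrite mevalM.
rewrite (dhomog_mevalZ _ _ homG) expr1.
have [->|t0] := eqVneq t 0; first by rewrite !mul0r.
have [->|GL] := eqVneq G.@[plucker L] 0; first by rewrite mulr0 mul0r.
have [_ /(_ t t0 GL) AL] := chart L.
by rewrite (P0 L _ AL ntL) mulr0.
Qed.

End Separation.


(** * Estimates for real polynomials *)

Section Box.
Variable R : realFieldType.

Definition box (m n : nat) (e : R) (A : 'M[R]_(m, n)) :=
  forall i j, `|A i j| <= e.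

Lemma box0 (m n : nat) (e : R) : 0 <= e -> box e (0 : 'M[R]_(m, n)).
Proof. by move=> e0 i j; rewrite mxE normr0. Qed.

Lemma boxW (m n : nat) (e e' : R) (A : 'M[R]_(m, n)) :
  box e A -> e <= e' -> box e' A.
Proof. by move=> eA ee' i j; apply: le_trans (eA i j) ee'. Qed.

Lemma boxD (m n : nat) (e e' : R) (A B : 'M[R]_(m, n)) :
  box e A -> box e' B -> box (e + e') (A + B).
Proof.
move=> eA eB i j; rewrite mxE; apply: le_trans (ler_normD _ _) _.
exact: lerD.
Qed.

Lemma boxN (m n : nat) (e : R) (A : 'M[R]_(m, n)) : box e A -> box e (- A).
Proof. by move=> eA i j; rewrite mxE normrN. Qed.

Lemma box_shift (m n : nat) (e e' : R) (A A0 : 'M[R]_(m, n)) :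
  box e A0 -> box e' (A - A0) -> box (e + e') A.
Proof. by move=> eA0 eA; rewrite -[A](subrKC A0); apply: boxD. Qed.

Lemma boxZ (m n : nat) (e a : R) (A : 'M[R]_(m, n)) :
  box e A -> box (`|a| * e) (a *: A).
Proof. by move=> eA i j; rewrite mxE normrM ler_wpM2l. Qed.

Lemma boxT (m n : nat) (e : R) (A : 'M[R]_(m, n)) : box e A -> box e A^T.
Proof. by move=> eA i j; rewrite mxE. Qed.

Lemma boxM (m n p : nat) (e e' : R) (A : 'M[R]_(m, n)) (B : 'M[R]_(n, p)) :
  box e A -> box e' B -> box (n%:R * (e * e')) (A *m B).
Proof.
move=> eA eB i j; rewrite mxE; apply: le_trans (ler_norm_sum _ _ _) _.
rewrite mulr_natl -[X in _ *+ X](card_ord n) -sumr_const.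
by apply: ler_sum => l _; rewrite normrM ler_pM.
Qed.

Lemma box_exists (m n : nat) (A : 'M[R]_(m, n)) : exists2 e, 0 <= e & box e A.
Proof.
exists (\sum_i \sum_j `|A i j|); first by do 2?apply: sumr_ge0 => ? _.
move=> i j; rewrite (bigD1 i) //= (bigD1 j) //= -!addrA lerDl addr_ge0 ?sumr_ge0 //.
by move=> a _; apply: sumr_ge0.
Qed.

End Box.

Section Taylor.
Variables (R : realFieldType) (n : nat).
Implicit Types (f g : {mpoly R[n]}) (x v : 'rV[R]_n).

Definition mdiff f x v := \sum_j (f^`M(j)).@[x ord0] * v 0 j.

(** The four bounds go through the induction together, because the remainder of a product involves
    values, differentials and increments of its factors. *)
Lemma mpoly_taylor (B : R) f : exists2 C, 0 <= C &
  forall x y e, box B x -> box B y -> 0 <= e <= 1 -> box e (y - x) ->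
  [/\ `|f.@[x ord0]| <= C, `|mdiff f x (y - x)| <= C * e,
      `|f.@[y ord0] - f.@[x ord0]| <= C * e &
      `|f.@[y ord0] - f.@[x ord0] - mdiff f x (y - x)| <= C * e ^+ 2].
Proof.
move: f; apply: mpoly_ring_ind => [c|i|f g|f g].
- exists `|c| => // x y e _ _ /andP[e0 _] _.
  have -> : mdiff c%:MP x (y - x) = 0.
    by rewrite /mdiff big1 // => j _; rewrite mderivC meval0 mul0r.
  by rewrite !mevalC subrr subr0 normr0 !mulr_ge0 ?sqr_ge0.
- have [B0|B0] := ltP B 0.
    exists 1 => // x y e /(_ 0 i) Bx.
    by have := le_lt_trans (le_trans (normr_ge0 _) Bx) B0; rewrite ltxx.
  exists (B + 1) => [|x y e Bx By /andP[e0 e1] yx]; first exact: addr_ge0.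
  have -> : mdiff 'X_i x (y - x) = (y - x) 0 i.
    rewrite /mdiff (bigD1 i) //= big1 => [|j ji].
      rewrite mderivX mnm1E eqxx scale1r (_ : (_ - _)%MM = 0%MM).
        by rewrite mpolyX0 meval1 mul1r addr0.
      by apply/mnmP => j; rewrite mnmBE mnm0E subnn.
    by rewrite mderivX mnm1E eq_sym (negPf ji) scale0r meval0 mul0r.
  have yxi := yx 0 i; rewrite !mxE in yxi *; rewrite !mevalXU !ord1 subrr normr0.
  have Be : e <= (B + 1) * e by rewrite mulrDl mul1r lerDr mulr_ge0.
  split; rewrite ?(le_trans yxi) // ?mulr_ge0 ?addr_ge0 ?sqr_ge0 //.
  by apply: le_trans (Bx 0 i) _; rewrite lerDl.
- move=> [C C0 fC] [D D0 gD]; exists (C + D) => [|x y e Bx By e01 yx].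
    exact: addr_ge0.
  have [f1 f2 f3 f4] := fC x y e Bx By e01 yx.
  have [g1 g2 g3 g4] := gD x y e Bx By e01 yx.
  have -> : mdiff (f + g) x (y - x) = mdiff f x (y - x) + mdiff g x (y - x).
    rewrite /mdiff -big_split; apply: eq_bigr => j _.
    by rewrite mderivD mevalD mulrDl.
  rewrite !mevalD !mulrDl; split.
  + exact: le_trans (ler_normD _ _) (lerD f1 g1).
  + exact: le_trans (ler_normD _ _) (lerD f2 g2).
  + by rewrite opprD addrACA; apply: le_trans (ler_normD _ _) (lerD f3 g3).
  + rewrite (_ : _ - _ = f.@[y ord0] - f.@[x ord0] - mdiff f x (y - x) +
        (g.@[y ord0] - g.@[x ord0] - mdiff g x (y - x))); last by ring.
    exact: le_trans (ler_normD _ _) (lerD f4 g4).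
- move=> [C C0 fC] [D D0 gD]; exists (4 * (C * D)) => [|x y e Bx By e01 yx].
    by rewrite !mulr_ge0.
  have [f1 f2 f3 f4] := fC x y e Bx By e01 yx.
  have [g1 g2 g3 g4] := gD x y e Bx By e01 yx.
  (* Applied to the pair [(y, y)], the induction hypothesis bounds [f] at [y] too. *)
  have yy : box e (y - y) by rewrite subrr; apply: box0; case/andP: e01.
  have [f1' _ _ _] := fC y y e By By e01 yy.
  have -> : mdiff (f * g) x (y - x) =
      mdiff f x (y - x) * g.@[x ord0] + f.@[x ord0] * mdiff g x (y - x).
    rewrite /mdiff mulr_suml mulr_sumr -big_split; apply: eq_bigr => j _ /=.
    by rewrite mderivM mevalD !mevalM; ring.
  rewrite !mevalM; have /andP[e0 e1] := e01.
  set fx := f.@[x ord0] in f1 f3 f4 *; set gx := g.@[x ord0] in g1 g3 g4 *.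
  set fy := f.@[y ord0] in f1' f3 f4 *; set gy := g.@[y ord0] in g3 g4 *.
  set df := mdiff f x _ in f2 f4 *; set dg := mdiff g x _ in g2 g4 *.
  have CD0 : 0 <= C * D by apply: mulr_ge0.
  have CDe0 : 0 <= C * D * e by apply: mulr_ge0.
  have CDee0 : 0 <= C * D * e ^+ 2 by rewrite mulr_ge0 ?sqr_ge0.
  have le_prod (a b a' b' : R) : `|a| <= a' -> `|b| <= b' -> `|a * b| <= a' * b'.
    by move=> aa bb; rewrite normrM ler_pM.
  split.
  + by apply: le_trans (le_prod _ _ _ _ f1 g1) _; lra.
  + apply: le_trans (ler_normD _ _) _.
    by have := le_prod _ _ _ _ f2 g1; have := le_prod _ _ _ _ f1 g2; lra.
  + have -> : fy * gy - fx * gx = fy * (gy - gx) + (fy - fx) * gx by ring.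
    apply: le_trans (ler_normD _ _) _.
    by have := le_prod _ _ _ _ f1' g3; have := le_prod _ _ _ _ f3 g1; lra.
  + have -> : fy * gy - fx * gx - (df * gx + fx * dg) =
      fy * (gy - gx - dg) + (fy - fx) * dg + (fy - fx - df) * gx by ring.
    apply: le_trans (ler_normD _ _) _.
    apply: le_trans (lerD (ler_normD _ _) (lexx _)) _.
    have := le_prod _ _ _ _ f1' g4; have := le_prod _ _ _ _ f3 g2.
    by have := le_prod _ _ _ _ f4 g1; lra.
Qed.

Lemma mpoly_bounded (B : R) f : exists2 C, 0 <= C &
  forall x, box B x -> `|f.@[x ord0]| <= C.
Proof.
have [C C0 fC] := mpoly_taylor B f; exists C => // x Bx.
have xx : box 0 (x - x) by rewrite subrr; apply: box0.
by have [] := fC x x 0 Bx Bx _ xx; rewrite // lexx ler01.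
Qed.

Lemma mpoly_lipschitz (B : R) f : exists2 C, 0 <= C &
  forall x y e, box B x -> box B y -> 0 <= e <= 1 -> box e (y - x) ->
  `|f.@[y ord0] - f.@[x ord0]| <= C * e.
Proof.
have [C C0 fC] := mpoly_taylor B f; exists C => // x y e Bx By e01 yx.
by have [] := fC x y e Bx By e01 yx.
Qed.

(** The quantitative form of vanishing at the common zeros of [E]; it turns membership of a minor in
    the ideal into an estimate. *)
Lemma ideal_span_bound (B : R) (E : {mpoly R[n]} -> Prop) f : ideal_span E f ->
  exists2 C, 0 <= C & forall x e, box B x ->
  (forall g, E g -> `|g.@[x ord0]| <= e) -> `|f.@[x ord0]| <= C * e.
Proof.
elim=> [|u g h Eg _ [C C0 hC]].
  by exists 0 => // x e _ _; rewrite meval0 normr0 mul0r.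
have [D D0 uD] := mpoly_bounded B u; exists (D + C) => [|x e Bx xE].
  exact: addr_ge0.
rewrite mevalD mevalM mulrDl; apply: le_trans (ler_normD _ _) (lerD _ (hC x e Bx xE)).
by rewrite normrM ler_pM // ?uD // xE.
Qed.

End Taylor.

Lemma finite_bound (R : realFieldType) (I : finType) (P : I -> R -> Prop) :
  (forall i, exists2 C, 0 <= C & P i C) ->
  (forall i C D, 0 <= C -> P i C -> C <= D -> P i D) ->
  exists2 C, 0 <= C & forall i, P i C.
Proof.
move=> exC monoP; have /choice[C CP] i : exists C, 0 <= C /\ P i C.
  by have [C] := exC i; exists C.
exists (\sum_i C i) => [|i]; first by apply: sumr_ge0 => i _; have [] := CP i.
have [Ci0 PC] := CP i; apply: monoP Ci0 PC _.
rewrite (bigD1 i) //= lerDl; apply: sumr_ge0 => j _; by have [] := CP j.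
Qed.

Lemma finite_bound_seq (R : realFieldType) (T : choiceType) (s : seq T)
    (P : T -> R -> Prop) :
  (forall t, t \in s -> exists2 C, 0 <= C & P t C) ->
  (forall t C D, 0 <= C -> P t C -> C <= D -> P t D) ->
  exists2 C, 0 <= C & forall t, t \in s -> P t C.
Proof.
move=> exC monoP; have [i|i C D|C C0 CP] :=
  @finite_bound R _ (fun (i : seq_sub s) C => P (val i) C) => //.
- by apply: exC; apply: (valP i).
- exact: monoP.
by exists C => // t st; apply: (CP (SeqSub st)).
Qed.


(** The sets of [e]-approximate zeros generate a proper filter on a compact cube; continuity makes
    its cluster points exact zeros. *)
Lemma compact_zero (R : realType) (k : nat) (ps : seq {mpoly R[k]})
    (y0 : 'rV[R]_k) (r : R) :
  (forall e, 0 < e -> exists y, box r (y - y0) /\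
     forall p, p \in ps -> `|p.@[y ord0]| <= e) ->
  exists y, box r (y - y0) /\ forall p, p \in ps -> p.@[y ord0] = 0.
Proof.
move=> approx; pose A (i : 'I_k) := [set` `[y0 ord0 i - r, y0 ord0 i + r]].
pose box_set := [set v : 'rV[R]_k | forall i, A i (v ord0 i)].
have box_setE v : box_set v <-> box r (v - y0).
  split=> [vA i j|vr i].
    by have := vA j; rewrite /A /= in_itv /= !mxE (ord1 i) ler_distl.
  by have := vr ord0 i; rewrite /A /= in_itv /= !mxE ler_distl.
have compactK : compact box_set by apply: rV_compact => i; apply: segment_compact.
pose S e := [set v : 'rV[R]_k | box_set v /\
  forall p, p \in ps -> `|p.@[v ord0]| <= e].
have filterS : Filter (filter_from [set e | 0 < e] S).
  apply: filter_from_filter; first by exists 1; apply: ltr01.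
  move=> e e' /= e0 e'0; exists (Num.min e e'); first by rewrite /= lt_min e0.
  move=> v [vK vp]; split; split=> // p pps; apply: le_trans (vp p pps) _;
  by rewrite ge_min lexx ?orbT.
have properS : ProperFilter (filter_from [set e | 0 < e] S).
  apply: filter_from_proper => e /approx[y [yr yp]].
  by exists y; split=> //; apply/box_setE.
have [|y [/box_setE yr clust]] := compactK _ properS.
  by exists 1 => [|v []]; first exact: ltr01.
exists y; split=> // p pps; apply: contrapT => /eqP py.
have [B B0 By] := box_exists y.
have [C C0 pC] := mpoly_lipschitz (B + 1) p.
pose eta := `|p.@[y ord0]|; have eta0 : 0 < eta by rewrite normr_gt0.
pose e := Num.min 1 (eta / (4 * (C + 1))).
have C1 : 0 < C + 1 by apply: ltr_wpDl.
have e0 : 0 < e by rewrite lt_min ltr01 divr_gt0 // mulr_gt0.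
have e1 : e <= 1 by rewrite ge_min lexx.
have Ce : C * e <= eta / 4.
  apply: (@le_trans _ _ ((C + 1) * (eta / (4 * (C + 1))))).
    by rewrite ler_pM ?(ltW e0) ?ge_min ?lexx ?orbT // lerDl.
  by have -> : (C + 1) * (eta / (4 * (C + 1))) = eta / 4 by field; rewrite gt_eqF.
(* At a point [v] of both sets [p] is at most [eta / 2] in absolute value and differs by at most
   [eta / 4] from its value at [y], whose absolute value is [eta]. *)
have := clust (S (eta / 2)) [set v | box e (v - y)].
case.
- by exists (eta / 2) => //=; apply: divr_gt0.
- exists (fun i j => ball (y i j) e) => [i j|v vy]; first exact: nbhsx_ballx.
  by move=> i j; rewrite !mxE distrC ltW //; apply: vy.
move=> v [[_ vp] vy].
have vB : box (B + 1) v.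
  exact: box_shift By (boxW vy _).
have yB : box (B + 1) y by apply: boxW By _; rewrite lerDl.
have := pC y v e yB vB; rewrite (ltW e0) e1 => /(_ isT vy) vyp.
have := vp p pps; have := lerB_dist p.@[y ord0] p.@[v ord0].
by rewrite distrC -/eta; move: eta0 vyp Ce; lra.
Qed.

Section LipschitzFunctions.
Variables (R : realFieldType) (k n : nat).
Implicit Types (phi psi : 'rV[R]_k -> 'M[R]_(k, n) -> R).

(** Including the bound on the values makes the class stable under products, hence under
    determinants and adjugates. *)
Definition loc_lipschitz phi := forall B, exists2 C, 0 <= C &
  forall y M y' M' e, box B y -> box B M -> box B y' -> box B M' ->
  0 <= e <= 1 -> box e (y' - y) -> box e (M' - M) ->
  `|phi y M| <= C /\ `|phi y' M' - phi y M| <= C * e.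

Lemma loc_lipschitz_cst c : loc_lipschitz (fun _ _ => c).
Proof.
move=> B; exists `|c| => // y M y' M' e _ _ _ _ /andP[e0 _] _ _.
by rewrite subrr normr0 mulr_ge0.
Qed.

Lemma loc_lipschitz_row i : loc_lipschitz (fun y _ => y 0 i).
Proof.
move=> B; exists (`|B| + 1) => [|y M y' M' e By _ _ _ /andP[e0 _] yy' _].
  by rewrite addr_ge0.
split; first by rewrite (le_trans (By 0 i)) // (le_trans (ler_norm B)) // lerDl.
by have := yy' 0 i; rewrite !mxE => /le_trans; apply; rewrite mulrDl mul1r lerDr mulr_ge0.
Qed.

Lemma loc_lipschitz_mx i j : loc_lipschitz (fun _ M => M i j).
Proof.
move=> B; exists (`|B| + 1) => [|y M y' M' e _ BM _ _ /andP[e0 _] _ MM'].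
  by rewrite addr_ge0.
split; first by rewrite (le_trans (BM i j)) // (le_trans (ler_norm B)) // lerDl.
by have := MM' i j; rewrite !mxE => /le_trans; apply; rewrite mulrDl mul1r lerDr mulr_ge0.
Qed.

Lemma loc_lipschitzD phi psi : loc_lipschitz phi -> loc_lipschitz psi ->
  loc_lipschitz (fun y M => phi y M + psi y M).
Proof.
move=> lphi lpsi B; have [C C0 hC] := lphi B; have [D D0 hD] := lpsi B.
exists (C + D) => [|y M y' M' e By BM By' BM' e01 yy' MM']; first exact: addr_ge0.
have [p1 p2] := hC y M y' M' e By BM By' BM' e01 yy' MM'.
have [q1 q2] := hD y M y' M' e By BM By' BM' e01 yy' MM'.
split; first exact: le_trans (ler_normD _ _) (lerD p1 q1).
by rewrite opprD addrACA mulrDl; apply: le_trans (ler_normD _ _) (lerD p2 q2).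
Qed.

Lemma loc_lipschitzM phi psi : loc_lipschitz phi -> loc_lipschitz psi ->
  loc_lipschitz (fun y M => phi y M * psi y M).
Proof.
move=> lphi lpsi B; have [C C0 hC] := lphi B; have [D D0 hD] := lpsi B.
exists (2 * (C * D)) => [|y M y' M' e By BM By' BM' e01 yy' MM'].
  by rewrite !mulr_ge0.
have [p1 p2] := hC y M y' M' e By BM By' BM' e01 yy' MM'.
have [q1 q2] := hD y M y' M' e By BM By' BM' e01 yy' MM'.
have [||p1' _] := hC y' M' y' M' e By' BM' By' BM' e01.
- by rewrite subrr; apply: box0; case/andP: e01.
- by rewrite subrr; apply: box0; case/andP: e01.
have CD : 0 <= C * D by apply: mulr_ge0.
have le_prod (a b a' b' : R) : `|a| <= a' -> `|b| <= b' -> `|a * b| <= a' * b'.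
  by move=> aa bb; rewrite normrM ler_pM.
split; first by apply: le_trans (le_prod _ _ _ _ p1 q1) _; lra.
rewrite (_ : _ - _ = phi y' M' * (psi y' M' - psi y M) +
  (phi y' M' - phi y M) * psi y M); last by ring.
apply: le_trans (ler_normD _ _) _.
by have := le_prod _ _ _ _ p1' q2; have := le_prod _ _ _ _ p2 q1; lra.
Qed.

Lemma eq_loc_lipschitz phi psi : (forall y M, phi y M = psi y M) ->
  loc_lipschitz phi -> loc_lipschitz psi.
Proof.
move=> e lphi B; have [C C0 hC] := lphi B; exists C => //.
by move=> y M y' M' r; rewrite -!e; apply: hC.
Qed.

Lemma loc_lipschitz_sum (I : Type) (r : seq I)
    (phi_ : I -> 'rV[R]_k -> 'M[R]_(k, n) -> R) :
  (forall i : I, loc_lipschitz (phi_ i)) ->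
  loc_lipschitz (fun y M => \sum_(i <- r) phi_ i y M).
Proof.
move=> lphi; elim: r => [|i r IH].
  apply: eq_loc_lipschitz (loc_lipschitz_cst 0) => y M.
  by rewrite big_nil.
by apply: eq_loc_lipschitz (loc_lipschitzD (lphi i) IH) => y M; rewrite big_cons.
Qed.

Lemma loc_lipschitz_prod (I : Type) (r : seq I)
    (phi_ : I -> 'rV[R]_k -> 'M[R]_(k, n) -> R) :
  (forall i : I, loc_lipschitz (phi_ i)) ->
  loc_lipschitz (fun y M => \prod_(i <- r) phi_ i y M).
Proof.
move=> lphi; elim: r => [|i r IH].
  apply: eq_loc_lipschitz (loc_lipschitz_cst 1) => y M.
  by rewrite big_nil.
by apply: eq_loc_lipschitz (loc_lipschitzM (lphi i) IH) => y M; rewrite big_cons.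
Qed.

Lemma loc_lipschitz_det (c : nat) (A : 'rV[R]_k -> 'M[R]_(k, n) -> 'M[R]_c) :
  (forall i j, loc_lipschitz (fun y M => A y M i j)) ->
  loc_lipschitz (fun y M => \det (A y M)).
Proof.
move=> lA; apply: loc_lipschitz_sum => s.
by apply: loc_lipschitzM; [exact: loc_lipschitz_cst|exact: loc_lipschitz_prod].
Qed.

Lemma loc_lipschitz_adj (c : nat) (A : 'rV[R]_k -> 'M[R]_(k, n) -> 'M[R]_c) i j :
  (forall i j, loc_lipschitz (fun y M => A y M i j)) ->
  loc_lipschitz (fun y M => (\adj (A y M)) i j).
Proof.
move=> lA.
apply: (@eq_loc_lipschitz (fun y M => (-1) ^+ (j + i) *
    \det (row' j (col' i (A y M))))) => [y M|]; first by rewrite !mxE.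
apply: loc_lipschitzM; first exact: loc_lipschitz_cst.
apply: loc_lipschitz_det => a b.
by apply: eq_loc_lipschitz (lA (lift j a) (lift i b)) => y M; rewrite !mxE.
Qed.

Lemma loc_lipschitz_meval (m : nat)
    (phi_ : 'I_m -> 'rV[R]_k -> 'M[R]_(k, n) -> R) (f : {mpoly R[m]}) :
  (forall i, loc_lipschitz (phi_ i)) ->
  loc_lipschitz (fun y M => f.@[fun i => phi_ i y M]).
Proof.
move=> lphi; move: f; apply: mpoly_ring_ind => [c|i|f g lf lg|f g lf lg].
- by apply: eq_loc_lipschitz (loc_lipschitz_cst c) => y M; rewrite mevalC.
- by apply: eq_loc_lipschitz (lphi i) => y M; rewrite mevalXU.
- by apply: eq_loc_lipschitz (loc_lipschitzD lf lg) => y M; rewrite mevalD.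
- by apply: eq_loc_lipschitz (loc_lipschitzM lf lg) => y M; rewrite mevalM.
Qed.

Lemma loc_lipschitz_bounded phi y0 M0 : loc_lipschitz phi ->
  exists2 C, 0 <= C & forall y M, box 1 (y - y0) -> box 1 (M - M0) ->
  `|phi y M| <= C.
Proof.
move=> lphi; have [B B0 By] := box_exists y0; have [D D0 DM] := box_exists M0.
have [C C0 hC] := lphi (B + D + 1); exists C => // y M y1 M1.
have By' : box (B + D + 1) y.
  apply: box_shift (boxW By _) y1.
  by rewrite lerDl.
have BM' : box (B + D + 1) M.
  apply: box_shift (boxW DM _) M1.
  by rewrite lerDr.
by have [] := hC y M y M 0 By' BM' By' BM'; rewrite ?lexx ?ler01 ?subrr //; apply: box0.
Qed.

Lemma loc_lipschitz_neq0 phi y0 M0 : loc_lipschitz phi -> phi y0 M0 != 0 ->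
  exists r eta, [/\ 0 < r <= 1, 0 < eta & forall y M,
    box r (y - y0) -> box r (M - M0) -> eta <= `|phi y M|].
Proof.
move=> lphi phi0; have [B B0 By] := box_exists y0.
have [D D0 DM] := box_exists M0; have [C C0 hC] := lphi (B + D + 1).
pose eta := `|phi y0 M0| / 2.
have eta0 : 0 < eta by rewrite divr_gt0 ?normr_gt0.
have C1 : 0 < C + 1 by apply: ltr_wpDl.
pose r := Num.min 1 (eta / (C + 1)).
have r0 : 0 < r by rewrite lt_min ltr01 divr_gt0.
have r1 : r <= 1 by rewrite ge_min lexx.
exists r, eta; split=> [||y M yr Mr]; rewrite ?r0 //.
have BD (m m' : nat) (A0 A : 'M[R]_(m, m')) : box (B + D) A0 -> box r (A - A0) ->
    box (B + D + 1) A /\ box (B + D + 1) A0.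
  move=> A0B Ar; split; last by apply: boxW A0B _; rewrite lerDl.
  exact: box_shift A0B (boxW Ar _).
have [|By' By0] := BD _ _ y0 y _ yr; first by apply: boxW By _; rewrite lerDl.
have [|BM' BM0] := BD _ _ M0 M _ Mr; first by apply: boxW DM _; rewrite lerDr.
have [|_] := hC y0 M0 y M r By0 BM0 By' BM' _ yr Mr; first by rewrite r1 ltW.
have Cr : C * r <= eta.
  apply: (@le_trans _ _ ((C + 1) * (eta / (C + 1)))).
    by rewrite ler_pM ?(ltW r0) ?ge_min ?lexx ?orbT // lerDl.
  by rewrite mulrCA divff ?mulr1 // gt_eqF.
have := lerB_dist (phi y0 M0) (phi y M); rewrite distrC.
have : `|phi y0 M0| = 2 * eta by rewrite /eta; field.
by move: Cr; lra.
Qed.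

End LipschitzFunctions.


(** * Persistence of transverse real intersections *)

Section Jacobian.
Variables (F : fieldType) (n : nat).

Definition jacobian (m : nat) (h : 'I_m -> {mpoly F[n]}) (x : 'rV[F]_n) : 'M[F]_(m, n) :=
  \matrix_i gradient (h i) x.

(** With the directions [V] fixed this is a polynomial in the point; by Cauchy-Binet it is a
    combination of the maximal minors of the Jacobian. *)
Definition jacobian_minor (m : nat) (h : 'I_m -> {mpoly F[n]})
    (V : 'M[F]_(m, n)) : {mpoly F[n]} :=
  \det (\matrix_(i, j) \sum_a (h i)^`M(a) * (V j a)%:MP).

Lemma jacobian_minorE m (h : 'I_m -> {mpoly F[n]}) V (x : 'rV[F]_n) :
  (jacobian_minor h V).@[x ord0] = \det (jacobian h x *m V^T).
Proof.
rewrite -[LHS]det_map_mx; congr (\det _); apply/matrixP => i j.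
rewrite !mxE raddf_sum /=; apply: eq_bigr => a _.
by rewrite !mxE mevalM mevalC.
Qed.

Lemma jacobian_minor_homogeneous m (h : 'I_m -> {mpoly F[n]}) V :
  (forall i, homogeneous (h i)) -> homogeneous (jacobian_minor h V).
Proof.
move=> hh; have /choice[d hd] i : exists d, h i \is d.-homog := hh i.
exists (\sum_i (d i).-1)%N; apply: dhomog_det => i j; rewrite mxE.
by apply: dhomog_sum => a _; apply/dhomog_MC/dhomog_mderiv.
Qed.

Definition snoc (T : Type) (m : nat) (h : 'I_m -> T) (t : T) : 'I_(m + 1) -> T :=
  fun i => if split i is inl a then h a else t.

Lemma jacobian_snoc m (h : 'I_m -> {mpoly F[n]}) g x :
  jacobian (snoc h g) x = col_mx (jacobian h x) (gradient g x).
Proof.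
apply/row_matrixP => i; rewrite rowK /snoc -[in RHS](splitK i).
case: (split i) => a /=; rewrite ?rowKu ?rowKd ?rowK //.
by apply/rowP => j; rewrite !mxE ord1.
Qed.

Lemma det_schur m (A : 'M[F]_m) B C (D : 'M[F]_1) : A \in unitmx ->
  \det (block_mx A B C D) = \det A * \det (D - C *m invmx A *m B).
Proof.
move=> Au; pose T := block_mx 1%:M (- (invmx A *m B)) 0 (1%:M : 'M[F]_1).
have : block_mx A B C D *m T = block_mx A 0 C (D - C *m invmx A *m B).
  rewrite mulmx_block !mulmx1 !mulmx0 !addr0 !mulmxN !mulmxA mulmxV // mul1mx.
  by rewrite addNr [- _ + _]addrC.
move=> /(congr1 determinant).
by rewrite det_mulmx det_lblock det_ublock !det1 mulr1 mulr1.
Qed.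

End Jacobian.

Section Flow.
Variables (R : realType) (c k n : nat).
Variables (f : 'I_c -> {mpoly R[n]}) (Gs : seq {mpoly R[n]}).
Variables (y0 : 'rV[R]_k) (M0 : 'M[R]_(k, n)) (s : 'I_c -> 'I_k).

Let W0 := rowsub s M0.
Let x0 := y0 *m M0.

Hypothesis transverse0 : \det (jacobian f x0 *m W0^T) != 0.
Hypothesis minors_span : forall g l, g \in Gs ->
  ideal_span (fun p => p \in Gs)
    (jacobian_minor (snoc f g) (col_mx W0 (delta_mx 0 l))).
Hypothesis Gs0 : forall g, g \in Gs -> g.@[x0 ord0] = 0.

Lemma mdiffE (g : {mpoly R[n]}) x v : mdiff g x v = (gradient g x *m v^T) 0 0.
Proof. by rewrite mxE; apply: eq_bigr => j _; rewrite !mxE. Qed.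

(** By the Schur complement formula, the minor of [(f, g)] in the directions [W0] and the [l]-th
    unit vector, divided by the determinant of [jacobian f x *m W0^T], is the [l]-th entry of the
    error of the combination. *)
Lemma gradient_combination g x : jacobian f x *m W0^T \in unitmx ->
  gradient g x = gradient g x *m W0^T *m invmx (jacobian f x *m W0^T) *m
      jacobian f x + (\det (jacobian f x *m W0^T))^-1 *:
    \row_l (jacobian_minor (snoc f g) (col_mx W0 (delta_mx 0 l))).@[x ord0].
Proof.
set A := jacobian f x *m W0^T => Au; apply/rowP => l.
have dA : \det A != 0 by rewrite -unitfE -unitmxE.
rewrite [RHS]mxE [X in _ + X]mxE [X in _ + _ * X]mxE.
rewrite jacobian_minorE jacobian_snoc tr_col_mx mul_col_row det_schur //.
rewrite mulKf // det_mx11 trmx_delta -!colE !mxE addrC.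
rewrite addrA -sumrB big1 ?add0r // => a _.
by rewrite [col _ _ _ _]mxE subrr.
Qed.

Lemma loc_lipschitz_point a :
  loc_lipschitz (fun (y : 'rV[R]_k) (M : 'M[R]_(k, n)) => (y *m M) 0 a).
Proof.
apply: (@eq_loc_lipschitz _ _ _ (fun y M => \sum_i y 0 i * M i a)).
  by move=> y M; rewrite mxE.
apply: loc_lipschitz_sum => i; apply: loc_lipschitzM.
  exact: loc_lipschitz_row.
exact: loc_lipschitz_mx.
Qed.

Lemma loc_lipschitz_poly (p : {mpoly R[n]}) : loc_lipschitz
  (fun (y : 'rV[R]_k) (M : 'M[R]_(k, n)) => p.@[(y *m M) ord0]).
Proof. exact: loc_lipschitz_meval loc_lipschitz_point. Qed.

Lemma loc_lipschitz_jacobian i a : loc_lipschitz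
  (fun (y : 'rV[R]_k) (M : 'M[R]_(k, n)) => jacobian f (y *m M) i a).
Proof.
apply: eq_loc_lipschitz (loc_lipschitz_poly (f i)^`M(a)) => y M.
by rewrite !mxE.
Qed.

Lemma box_loc_lipschitz (p q : nat)
    (A : 'rV[R]_k -> 'M[R]_(k, n) -> 'M[R]_(p, q)) :
  (forall i j, loc_lipschitz (fun y M => A y M i j)) ->
  exists2 C, 0 <= C & forall y M, box 1 (y - y0) -> box 1 (M - M0) ->
  box C (A y M).
Proof.
move=> lA; have [ij|ij C D _ CP CD|C C0 CP] := @finite_bound R _
  (fun (ij : 'I_p * 'I_q) C => forall y M, box 1 (y - y0) -> box 1 (M - M0) ->
    `|A y M ij.1 ij.2| <= C).
- exact: loc_lipschitz_bounded.
- by move=> y M y1 M1; apply: le_trans (CP y M y1 M1) CD.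
- by exists C => // y M y1 M1 i j; apply: (CP (i, j)).
Qed.

Lemma box_invmx (A : 'rV[R]_k -> 'M[R]_(k, n) -> 'M[R]_c) :
  (forall i j, loc_lipschitz (fun y M => A y M i j)) -> \det (A y0 M0) != 0 ->
  exists r C, [/\ 0 < r <= 1, 0 <= C & forall y M,
    box r (y - y0) -> box r (M - M0) -> [/\ A y M \in unitmx,
      `|(\det (A y M))^-1| <= C & box C (invmx (A y M))]].
Proof.
move=> lA detA; have [r [eta [r01 eta0 detP]]] :=
  loc_lipschitz_neq0 (loc_lipschitz_det lA) detA.
have [C C0 adjP] := box_loc_lipschitz (fun i j => loc_lipschitz_adj i j lA).
exists r, (eta^-1 + eta^-1 * C); have eta'0 : 0 <= eta^-1 by rewrite invr_ge0 ltW.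
split=> // [|y M yr Mr]; first by rewrite addr_ge0 ?mulr_ge0.
have detyM := detP y M yr Mr.
have detyM0 : 0 < `|\det (A y M)| by apply: lt_le_trans detyM.
have unitA : A y M \in unitmx by rewrite unitmxE unitfE -normr_gt0.
have inv_le : `|(\det (A y M))^-1| <= eta^-1.
  by rewrite normfV lef_pV2 // posrE.
split=> //; first by apply: le_trans inv_le _; rewrite lerDl mulr_ge0.
have /andP[_ r1] := r01.
have adjA := adjP y M (boxW yr r1) (boxW Mr r1).
rewrite /invmx unitA => i j; rewrite mxE normrM.
by apply: le_trans (ler_pM _ _ inv_le (adjA i j)) _; rewrite // lerDr.
Qed.

(** The Euler step corrects within the rows of the moving [M] and so inverts [Wmx]. The estimate of
    gradients uses [Amx], with the fixed directions [W0], so that its minors are fixed polynomials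
    of the ideal. Both matrices agree at [(y0, M0)]. *)
Let Wmx (y : 'rV[R]_k) (M : 'M[R]_(k, n)) :=
  jacobian f (y *m M) *m (rowsub s M)^T.

Let Amx (y : 'rV[R]_k) (M : 'M[R]_(k, n)) := jacobian f (y *m M) *m W0^T.

Lemma gradient_bound g : g \in Gs -> exists r K, [/\ 0 < r <= 1, 0 <= K &
  forall y M v tau delta gamma, box r (y - y0) -> box r (M - M0) ->
  0 <= tau -> box tau (jacobian f (y *m M) *m v^T) ->
  0 <= delta -> box delta v ->
  0 <= gamma -> (forall g', g' \in Gs -> `|g'.@[(y *m M) ord0]| <= gamma) ->
  `|mdiff g (y *m M) v| <= K * (tau + delta * gamma)].
Proof.
move=> gGs; have lA i j : loc_lipschitz (fun y M => Amx y M i j).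
  apply: (@eq_loc_lipschitz _ _ _
    (fun y M => \sum_a jacobian f (y *m M) i a * W0^T a j)) => [y M|].
    by rewrite mxE.
  apply: loc_lipschitz_sum => a; apply: loc_lipschitzM.
    exact: loc_lipschitz_jacobian.
  exact: loc_lipschitz_cst.
have [r [C [r01 C0 invA]]] := box_invmx lA transverse0.
have [D D0 gD] : exists2 D, 0 <= D & forall y M, box 1 (y - y0) ->
    box 1 (M - M0) -> box D (gradient g (y *m M)).
  apply: box_loc_lipschitz => i j.
  by apply: eq_loc_lipschitz (loc_lipschitz_poly g^`M(j)) => y M; rewrite mxE.
have [B B0 xB] : exists2 B, 0 <= B & forall y M, box 1 (y - y0) ->
    box 1 (M - M0) -> box B (y *m M).
  by apply: box_loc_lipschitz => i j; rewrite (ord1 i); apply: loc_lipschitz_point.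
have [E E0 WE] := box_exists W0.
pose minor l := jacobian_minor (snoc f g) (col_mx W0 (delta_mx 0 l)).
pose minor_bound (l : 'I_n) H := forall (x : 'rV[R]_n) e, box B x ->
  (forall g', g' \in Gs -> `|g'.@[x ord0]| <= e) ->
  `|(minor l).@[x ord0]| <= H * `|e|.
have [H H0 minorH] : exists2 H, 0 <= H & forall l, minor_bound l H.
  apply: finite_bound => [l|l a b _ aP ab].
  - have [H H0 HP] := ideal_span_bound B (minors_span l gGs).
    exists H => // x e Bx xe; apply: le_trans (HP x e Bx xe) _.
    by rewrite ler_wpM2l // ler_norm.
  - move=> x e Bx xe; apply: le_trans (aP x e Bx xe) _.
    by rewrite ler_wpM2r.
pose K1 := c%:R * (c%:R * (n%:R * (D * E) * C)); pose K2 := n%:R * (C * H).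
have K10 : 0 <= K1 by rewrite !mulr_ge0.
have K20 : 0 <= K2 by rewrite !mulr_ge0.
exists r, (K1 + K2); split=> //; first exact: addr_ge0.
move=> y M v tau delta gamma yr Mr tau0 tauv delta0 deltav gamma0 Ggamma.
have /andP[_ r1] := r01; have y1 := boxW yr r1; have M1 := boxW Mr r1.
have [Au detC invC] := invA y M yr Mr.
rewrite mdiffE (gradient_combination g Au) mulmxDl mxE.
apply: le_trans (ler_normD _ _) _.
have b1 : box (K1 * tau) (gradient g (y *m M) *m W0^T *m invmx (Amx y M) *m
    jacobian f (y *m M) *m v^T).
  rewrite -mulmxA /K1 -mulrA; apply: boxM tauv; apply: boxM invC.
  by apply: boxM (gD y M y1 M1) (boxT WE).
have b2 : box (K2 * (delta * gamma)) ((\det (Amx y M))^-1 *: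
    (\row_l (jacobian_minor (snoc f g) (col_mx W0 (delta_mx 0 l))).@[(y *m M) ord0])
      *m v^T).
  rewrite (_ : K2 * _ = n%:R * ((C * (H * gamma)) * delta)); last by rewrite /K2; ring.
  apply: boxM (boxT deltav) => i j; rewrite mxE normrM ler_pM // mxE.
  by have := minorH j _ _ (xB y M y1 M1) Ggamma; rewrite (ger0_norm gamma0).
have := b1 0 0; have := b2 0 0.
have : 0 <= K1 * (delta * gamma) by rewrite !mulr_ge0.
have : 0 <= K2 * tau by rewrite mulr_ge0.
by rewrite -/(Amx y M); lra.
Qed.

Lemma gradients_bound : exists r K, [/\ 0 < r <= 1, 0 <= K &
  forall g y M v tau delta gamma, g \in Gs ->
  box r (y - y0) -> box r (M - M0) ->
  0 <= tau -> box tau (jacobian f (y *m M) *m v^T) ->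
  0 <= delta -> box delta v ->
  0 <= gamma -> (forall g', g' \in Gs -> `|g'.@[(y *m M) ord0]| <= gamma) ->
  `|mdiff g (y *m M) v| <= K * (tau + delta * gamma)].
Proof.
(* Tying the radius to the constant as [(K + 1)^-1] leaves one monotone parameter, as
   [finite_bound_seq] requires. *)
pose P g (K : R) := forall y M v tau delta gamma,
  box (K + 1)^-1 (y - y0) -> box (K + 1)^-1 (M - M0) ->
  0 <= tau -> box tau (jacobian f (y *m M) *m v^T) ->
  0 <= delta -> box delta v ->
  0 <= gamma -> (forall g', g' \in Gs -> `|g'.@[(y *m M) ord0]| <= gamma) ->
  `|mdiff g (y *m M) v| <= K * (tau + delta * gamma).
have [g gGs|g C D C0 PC CD|K K0 KP] := @finite_bound_seq R _ Gs P.
- have [r [K [/andP[r0 r1] K0 KP]]] := gradient_bound gGs.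
  have rK : (K + r^-1 + 1)^-1 <= r.
    rewrite -[X in _ <= X]invrK lef_pV2 ?posrE ?invr_gt0 //.
      by rewrite addrAC lerDr addr_ge0.
    by rewrite addr_gt0 // ltr_wpDl ?invr_gt0.
  exists (K + r^-1) => [|y M v tau delta gamma yK MK tau0 tauv d0 dv g0 gg].
    by rewrite addr_ge0 // invr_ge0 ltW.
  have le_v := KP y M v tau delta gamma (boxW yK rK) (boxW MK rK).
  apply: le_trans (le_v _ _ _ _ _ _) _ => //.
  by rewrite ler_wpM2r ?lerDl ?invr_ge0 ?(ltW r0) // addr_ge0 ?mulr_ge0.
- move=> y M v tau delta gamma yD MD tau0 tauv d0 dv g0 gg.
  have DC : (D + 1)^-1 <= (C + 1)^-1.
    by rewrite lef_pV2 ?lerD2r // posrE ltr_wpDl // (le_trans C0).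
  have le_v := PC y M v tau delta gamma (boxW yD DC) (boxW MD DC).
  apply: le_trans (le_v _ _ _ _ _ _) _ => //.
  by rewrite ler_wpM2r // addr_ge0 ?mulr_ge0.
have K1 : 0 < K + 1 by apply: ltr_wpDl.
exists (K + 1)^-1, K; split=> // [|g y M v tau delta gamma gGs yr Mr t0 tv d0 dv g0 gg].
  by rewrite invr_gt0 K1 /= invf_le1 // lerDr.
exact: KP gg.
Qed.

Lemma flow_constants : exists r K, [/\ 0 < r <= 1, 0 <= K &
  forall y M, box r (y - y0) -> box r (M - M0) -> [/\
    box K y /\ box K M, box K (y *m M), box K (jacobian f (y *m M)),
    Wmx y M \in unitmx /\ box K (invmx (Wmx y M)) &
    forall g v tau delta gamma, g \in Gs ->
      0 <= tau -> box tau (jacobian f (y *m M) *m v^T) ->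
      0 <= delta -> box delta v ->
      0 <= gamma -> (forall g', g' \in Gs -> `|g'.@[(y *m M) ord0]| <= gamma) ->
      `|mdiff g (y *m M) v| <= K * (tau + delta * gamma)]].
Proof.
have lW i j : loc_lipschitz (fun y M => Wmx y M i j).
  apply: (@eq_loc_lipschitz _ _ _
    (fun y M => \sum_a jacobian f (y *m M) i a * M (s j) a)) => [y M|].
    by rewrite mxE; apply: eq_bigr => a _; rewrite !mxE.
  apply: loc_lipschitz_sum => a; apply: loc_lipschitzM.
    exact: loc_lipschitz_jacobian.
  exact: loc_lipschitz_mx.
have [r1 [K1 [/andP[r1_gt0 r1_le1] K1_ge0 WP]]] := box_invmx lW transverse0.
have [r2 [K2 [/andP[r2_gt0 r2_le1] K2_ge0 GP]]] := gradients_bound.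
have [K3 K3_ge0 yP] : exists2 K, 0 <= K & forall y M, box 1 (y - y0) ->
    box 1 (M - M0) -> box K y.
  apply: box_loc_lipschitz => i j; rewrite (ord1 i); exact: loc_lipschitz_row.
have [K4 K4_ge0 MP] : exists2 K, 0 <= K & forall y M, box 1 (y - y0) ->
    box 1 (M - M0) -> box K M.
  apply: box_loc_lipschitz => i j; exact: loc_lipschitz_mx.
have [K5 K5_ge0 xP] : exists2 K, 0 <= K & forall y M, box 1 (y - y0) ->
    box 1 (M - M0) -> box K (y *m M).
  apply: box_loc_lipschitz => i j; rewrite (ord1 i); exact: loc_lipschitz_point.
have [K6 K6_ge0 JP] : exists2 K, 0 <= K & forall y M, box 1 (y - y0) ->
    box 1 (M - M0) -> box K (jacobian f (y *m M)).
  apply: box_loc_lipschitz => i j; exact: loc_lipschitz_jacobian.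
have r1_le : Num.min r1 r2 <= r1 by rewrite ge_min lexx.
have r2_le : Num.min r1 r2 <= r2 by rewrite ge_min lexx orbT.
exists (Num.min r1 r2), (K1 + K2 + K3 + K4 + K5 + K6).
split=> [||y M yr Mr].
- by rewrite lt_min r1_gt0 r2_gt0 (le_trans r1_le).
- by rewrite !addr_ge0.
have yr1 := boxW yr r1_le; have Mr1 := boxW Mr r1_le.
have yr2 := boxW yr r2_le; have Mr2 := boxW Mr r2_le.
have y1 := boxW yr1 r1_le1; have M1 := boxW Mr1 r1_le1.
have [Wu _ Wi] := WP y M yr1 Mr1.
split.
- by split; [apply: boxW (yP y M y1 M1) _|apply: boxW (MP y M y1 M1) _]; lra.
- by apply: boxW (xP y M y1 M1) _; lra.
- by apply: boxW (JP y M y1 M1) _; lra.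
- by split=> //; apply: boxW Wi _; lra.
move=> g v tau delta gamma gGs t0 tv d0 dv g0 gg.
apply: le_trans (GP g y M v tau delta gamma gGs yr2 Mr2 t0 tv d0 dv g0 gg) _.
by rewrite ler_wpM2r ?addr_ge0 ?mulr_ge0 //; lra.
Qed.

(* One step of Euler's method along the path M + h N: the point y moves inside
   the span of the rows selected by s so as to stay tangent to the common zeros
   of the f i. *)
Lemma flow_step : exists r K, [/\ 0 < r <= 1, 0 <= K &
  forall y M N e h gamma, box r (y - y0) -> box r (M - M0) ->
  box e N -> 0 <= e <= 1 -> K * e <= 1 -> 0 <= h <= 1 -> 0 <= gamma ->
  (forall g, g \in Gs -> `|g.@[(y *m M) ord0]| <= gamma) ->
  exists2 y', box (K * e * h) (y' - y) & forall g, g \in Gs ->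
    `|g.@[(y' *m (M + h *: N)) ord0]| <=
      gamma + K * e * h * gamma + K * (e * h) ^+ 2].
Proof.
have [r [K [/andP[r0 r1] K0 KP]]] := flow_constants.
have [g gGs|g C D C0 CP CD|C C0 CP] := @finite_bound_seq R _ Gs
  (fun g C => forall x x' e, box (K + 1) x -> box (K + 1) x' -> 0 <= e <= 1 ->
    box e (x' - x) ->
    `|g.@[x' ord0] - g.@[x ord0] - mdiff g x (x' - x)| <= C * e ^+ 2).
- have [C C0 CP] := mpoly_taylor (K + 1) g; exists C => // x x' e xK x'K e01 xx'.
  by have [] := CP x x' e xK x'K e01 xx'.
- move=> x x' e xK x'K e01 xx'; apply: le_trans (CP x x' e xK x'K e01 xx') _.
  by rewrite ler_wpM2r // sqr_ge0.
(* In units of [h * e], the constants [c2], [c3] and [c4] bound [z], [z *m E] and [x' - x]; [c5]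
   bounds [J *m (x' - x)^T] in units of [(h * e) ^+ 2]. *)
pose c2 := c%:R * (K * (n%:R * (K * (k%:R * K)))).
pose c3 := c%:R * c2.
pose c4 := k%:R * K + k%:R * (c3 * K) + k%:R * c3.
pose c5 := n%:R * (K * (k%:R * c3)).
have c2_ge0 : 0 <= c2 by rewrite !mulr_ge0.
have c3_ge0 : 0 <= c3 by rewrite !mulr_ge0.
have c4_ge0 : 0 <= c4 by rewrite !addr_ge0 // !mulr_ge0.
have c5_ge0 : 0 <= c5 by rewrite !mulr_ge0.
pose L := c3 + c4 + K * c4 + (K * c5 + C * c4 ^+ 2).
have Kc4_ge0 : 0 <= K * c4 by rewrite mulr_ge0.
have Kc5_ge0 : 0 <= K * c5 by rewrite mulr_ge0.
have Cc4_ge0 : 0 <= C * c4 ^+ 2 by rewrite mulr_ge0 ?sqr_ge0.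
exists r, L; split=> [||y M N e h gamma yr Mr Ne /andP[e0 e1] Le /andP[h0 h1] gamma0 gg].
- by rewrite r0.
- by rewrite /L; lra.
have [[Ky KM] Kx KJ [Wu KW] Kgrad] := KP y M yr Mr.
set x := y *m M in Kx KJ Kgrad gg *; set J := jacobian f x in KJ Kgrad *.
have he0 : 0 <= h * e by apply: mulr_ge0.
have le_prod1 (a b : R) : 0 <= a -> 0 <= b <= 1 -> a * b <= a.
  by move=> a0 /andP[b0 b1]; rewrite ler_piMr.
pose q := J *m (y *m N)^T.
have qb : box (n%:R * (K * (k%:R * (K * e)))) q.
  by apply: boxM KJ _; apply/boxT/boxM.
(* Moving along [N] changes the [f i] to first order by [h *: q]; [z] solves the linear system that
   cancels this, so that [J] sees only the mixed term [h *: (z *m E *m N)] of the displacement. *)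
pose z := - h *: (invmx (Wmx y M) *m q)^T.
have zb : box (c2 * (h * e)) z.
  rewrite (_ : c2 * _ = `|- h| * (c%:R * (K * (n%:R * (K * (k%:R * (K * e))))))).
    by apply/boxZ/boxT/boxM.
  by rewrite normrN ger0_norm // /c2; ring.
pose E : 'M[R]_(c, k) := rowsub s 1%:M.
have Eb : box 1 E.
  by move=> i j; rewrite !mxE; case: eqP => _; rewrite ?normr1 ?normr0 ?ler01.
have EM (A : 'M[R]_(k, n)) : rowsub s A = E *m A by rewrite mul_rowsub_mx mul1mx.
have zEb : box (c3 * (h * e)) (z *m E).
  rewrite (_ : c3 * _ = c%:R * ((c2 * (h * e)) * 1)); last by rewrite /c3; ring.
  exact: boxM.
pose y' := y + z *m E; pose x' := y' *m (M + h *: N).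
have xx' : x' - x = h *: (y *m N) + z *m E *m M + h *: (z *m E *m N).
  rewrite /x' /y' mulmxDl !mulmxDr -!scalemxAr -/x addrC addrA addrA addKr -addrA.
  by rewrite addrA.
have xx'_box : box (c4 * (h * e)) (x' - x).
  rewrite xx' /c4 !mulrDl; apply: boxD; first apply: boxD.
  - rewrite (_ : _ * (h * e) = `|h| * (k%:R * (K * e))); first exact/boxZ/boxM.
    by rewrite ger0_norm //; ring.
  - rewrite (_ : _ * (h * e) = k%:R * ((c3 * (h * e)) * K)); first exact: boxM.
    by ring.
  - apply: (@boxW _ _ _ (`|h| * (k%:R * ((c3 * (h * e)) * e)))); first exact/boxZ/boxM.
    rewrite ger0_norm //.
    have -> : h * (k%:R * (c3 * (h * e) * e)) = k%:R * c3 * (h * e) * (h * e) by ring.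
    by apply: le_prod1; [rewrite !mulr_ge0|rewrite he0 mulr_ile1].
have Jxx' : J *m (x' - x)^T = h *: (J *m (z *m E *m N)^T).
  rewrite xx' !linearD /= !linearZ /= -/q.
  rewrite [X in _ + X + _](_ : _ = - h *: q) ?scaleNr ?subrr ?add0r //.
  rewrite -mulmxA -EM trmx_mul mulmxA -/(Wmx y M) /z linearZ /= trmxK -scalemxAr.
  by rewrite mulmxA mulmxV // mul1mx scaleNr.
have Jxx'_box : box (c5 * (h * e) ^+ 2) (J *m (x' - x)^T).
  rewrite Jxx' (_ : c5 * _ = `|h| * (n%:R * (K * (k%:R * ((c3 * (h * e)) * e))))).
    by apply/boxZ; apply: boxM KJ _; apply/boxT/boxM.
  by rewrite ger0_norm // /c5; ring.
have c4he : 0 <= c4 * (h * e) <= 1.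
  rewrite mulr_ge0 //= mulrCA; apply: mulr_ile1 => //; first by rewrite mulr_ge0.
  apply: le_trans Le; rewrite ler_wpM2r // /L; lra.
have x'K : box (K + 1) x'.
  by apply: box_shift Kx (boxW xx'_box _); case/andP: c4he.
exists y' => [|g gGs].
  rewrite /y' addrC addKr; apply: boxW zEb _.
  by rewrite [h * e]mulrC -mulrA ler_wpM2r ?[e * h]mulrC // /L; lra.
have Kx1 : box (K + 1) x by apply: boxW Kx _; rewrite lerDl.
have taylor := CP g gGs x x' _ Kx1 x'K c4he xx'_box.
have diff := Kgrad g (x' - x) _ _ gamma gGs (mulr_ge0 c5_ge0 (sqr_ge0 _)) Jxx'_box
  (mulr_ge0 c4_ge0 he0) xx'_box gamma0 gg.
have gx := gg g gGs.
have -> : g.@[x' ord0] = g.@[x ord0] + mdiff g x (x' - x) +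
    (g.@[x' ord0] - g.@[x ord0] - mdiff g x (x' - x)).
  by rewrite -[X in _ + X]addrA -opprD subrKC.
apply: le_trans (ler_normD _ _) _; apply: le_trans (lerD (ler_normD _ _) (lexx _)) _.
apply: le_trans (lerD (lerD gx diff) taylor) _.
have -> : L * e * h = L * (h * e) by ring.
have : K * c4 * (h * e) * gamma <= L * (h * e) * gamma.
  rewrite ler_wpM2r // ler_wpM2r // /L; lra.
have : (K * c5 + C * c4 ^+ 2) * (h * e) ^+ 2 <= L * (h * e) ^+ 2.
  by rewrite ler_wpM2r ?sqr_ge0 // /L; lra.
by rewrite [e * h]mulrC; move: (h * e) => t; rewrite exprMn; lra.
Qed.

(* With step h = 1/m, the errors [g <= j h^2] after j steps satisfy the
   recursion of [flow_step] as soon as [2 K e <= 1], so the endpoints are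
   approximate zeros with error 1/m. *)
Theorem flow_zero rho : 0 < rho -> exists2 e, 0 < e &
  forall M1, box e (M1 - M0) -> exists y, box rho (y - y0) /\
    forall g, g \in Gs -> g.@[(y *m M1) ord0] = 0.
Proof.
move=> rho0; have [r [K [/andP[r0 r1] K0 stepP]]] := flow_step.
have K1 : 0 < 2 * (K + 1) by rewrite mulr_gt0 // ltr_wpDl.
pose t := Num.min r rho; have t0 : 0 < t by rewrite lt_min r0.
(* With this [e] the whole path moves [y] by at most [K * e <= t], within both radii, and
   [2 * K * e <= 1] because [t <= r <= 1]. *)
pose e := t / (2 * (K + 1)); have e0 : 0 < e by rewrite divr_gt0.
have eE : 2 * (K + 1) * e = t by rewrite /e mulrC divfK // gt_eqF.
have tr : t <= r by rewrite ge_min lexx.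
have trho : t <= rho by rewrite ge_min lexx orbT.
have Ke0 : 0 <= K * e by rewrite mulr_ge0 // ltW.
have Ke : K * e <= 1 / 2 by lra.
have Ket : K * e <= t by lra.
have er : e <= r by lra.
have e1 : e <= 1 by lra.
exists e => // M1 M1e.
have approx (m : nat) : (0 < m)%N -> exists y, box rho (y - y0) /\
    forall g, g \in Gs -> `|g.@[(y *m M1) ord0]| <= m%:R^-1.
  move=> m0; pose h : R := m%:R^-1.
  have m0R : 0 < m%:R :> R by rewrite ltr0n.
  have h0 : 0 < h by rewrite invr_gt0.
  have mh : m%:R * h = 1 by rewrite divff // gt_eqF.
  have h1 : h <= 1 by rewrite invf_le1 // ler1n.
  have jh j : (j <= m)%N -> j%:R * h <= 1.
    by move=> jm; rewrite -[X in _ <= X]mh ler_wpM2r ?ler_nat // ltW.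
  have chain j : (j <= m)%N -> exists y, box (K * e * (j%:R * h)) (y - y0) /\
      forall g, g \in Gs ->
      `|g.@[(y *m (M0 + (j%:R * h) *: (M1 - M0))) ord0]| <= j%:R * h ^+ 2.
    elim: j => [_|j IH jm].
      exists y0; split=> [|g gGs].
        by rewrite subrr; apply: box0; rewrite mul0r mulr0.
      by rewrite !mul0r scale0r addr0 -/x0 Gs0 // normr0.
    have [y [yb yg]] := IH (ltnW jm).
    have jh0 : 0 <= j%:R * h by rewrite mulr_ge0 ?ler0n // ltW.
    have jh1 := jh j (ltnW jm).
    have yr : box r (y - y0).
      apply: boxW yb _; have : K * e * (j%:R * h) <= K * e by rewrite ler_piMr.
      by lra.
    have Mr : box r (M0 + (j%:R * h) *: (M1 - M0) - M0).
      rewrite addrAC subrr add0r; apply: boxW (boxZ _ M1e) _.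
      by rewrite ger0_norm //; apply: le_trans er; rewrite ler_piMl // ltW.
    have [||||y' y'b y'g] := stepP y _ _ e h (j%:R * h ^+ 2) yr Mr M1e _ _ _ _ yg.
    - by rewrite ltW.
    - by lra.
    - by rewrite (ltW h0).
    - by rewrite mulr_ge0 ?ler0n ?sqr_ge0.
    exists y'; split=> [|g gGs].
      have := boxD y'b yb; rewrite addrA subrK => y'b0; apply: boxW y'b0 _.
      by rewrite -natr1 mulrDl mul1r mulrDr addrC.
    have := y'g g gGs; rewrite -addrA -scalerDl -{2}[h]mul1r -mulrDl natr1.
    move=> /le_trans; apply; rewrite -natr1 mulrDl mul1r -addrA lerD2l.
    have -> : K * e * h * (j%:R * h ^+ 2) = (K * e) * (j%:R * h) * h ^+ 2 by ring.
    have -> : K * (e * h) ^+ 2 = (K * e) * e * h ^+ 2 by ring.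
    rewrite -mulrDl; apply: ler_piMl; first exact: sqr_ge0.
    have : (K * e) * (j%:R * h) <= K * e by rewrite ler_piMr.
    have : (K * e) * e <= K * e by rewrite ler_piMr.
    by lra.
  have [y [yb yg]] := chain m (leqnn m); exists y; split.
    by apply: boxW yb _; rewrite mh mulr1; lra.
  move=> g gGs; have := yg g gGs.
  by rewrite expr2 mulrA mh scale1r mul1r addrC subrK.
pose ps := [seq g \mPo linear_forms M1 | g <- Gs].
have [d d0|y [yb yps]] := @compact_zero R k ps y0 rho.
  have [y [yb yg]] := approx (Num.bound d^-1).+1 (ltn0Sn _).
  exists y; split=> // _ /mapP[g gGs ->]; rewrite meval_linear_forms.
  apply: le_trans (yg g gGs) _; rewrite -[X in _ <= X]invrK.
  rewrite lef_pV2 ?posrE ?invr_gt0 ?ltr0n //.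
  apply: le_trans (ltW (archi_boundP _)) _; first by rewrite invr_ge0 ltW.
  by rewrite ler_nat.
exists y; split=> // g gGs; rewrite -meval_linear_forms; apply: yps.
exact: map_f.
Qed.

End Flow.


(** * Open subsets of the real Grassmannian *)

Section GrassmannianTopology.
Variables (R : realType) (k n : nat).

(** Openness in the quotient of a subspace asks for an open set of matrices whose trace on the
    frames is the preimage of [O]. The interior of [P] serves, matrices of smaller rank belonging to
    [P] vacuously. *)
Lemma Gr_open (O : set (Gr R k n)) :
  (forall (A : 'M[R]_(k, n)) (freeA : row_free A), O (Gr_span freeA) ->
    exists2 e, 0 < e & forall (M : 'M[R]_(k, n)) (freeM : row_free M),
      box e (M - A) -> O (Gr_span freeM)) -> open O.
Proof.
move=> locO; pose P : set 'M[R]_(k, n) :=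
  [set M | forall freeM : row_free M, O (Gr_span freeM)].
have PE (a : @frames R k n) : O (\pi_(Gr R k n) a) <-> P (val a).
  have aE (freeA : row_free (val a)) : \pi_(Gr R k n) a = Gr_span freeA.
    rewrite /Gr_span; congr (\pi_(Gr R k n) _); exact: val_inj.
  have free_a : row_free (val a) by apply: set_mem (valP a).
  by split=> [Oa freeA|/(_ free_a)]; rewrite -aE.
exists (interior P); first exact: open_interior.
apply/seteqP; split=> a.
  by move=> /interior_subset/PE.
move=> Oa; have free_a : row_free (val a) by apply: set_mem (valP a).
have /locO[e e0 Oe] : O (Gr_span free_a) by have /PE := Oa; apply.
exists (fun i j => ball (val a i j) e) => [i j|M Ma freeM]; first exact: nbhsx_ballx.
by apply: Oe => i j; rewrite !mxE distrC ltW //; apply: Ma.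
Qed.

End GrassmannianTopology.


(** * Varieties defined over the reals *)

Section MapMpoly.
Variables (F K : fieldType) (phi : {rmorphism F -> K}) (n : nat).
Implicit Types f : {mpoly F[n]}.

Lemma meval_map_mpoly f v :
  (map_mpoly phi f).@[fun i => phi (v i)] = phi f.@[v].
Proof.
move: f; apply: mpoly_ring_ind => [c|i|f g IHf IHg|f g IHf IHg].
- by rewrite map_mpolyC !mevalC.
- by rewrite map_mpolyX !mevalXU.
- by rewrite raddfD /= !mevalD raddfD IHf IHg.
- by rewrite [map_mpoly _ _]rmorphM /= !mevalM rmorphM IHf IHg.
Qed.

Lemma map_mpoly_meval_mx f (x : 'rV[F]_n) :
  (map_mpoly phi f).@[(map_mx phi x) ord0] = phi f.@[x ord0].
Proof. by rewrite -meval_map_mpoly; apply: meval_eq => i; rewrite mxE. Qed.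

Lemma map_mpoly_mderiv f i : (map_mpoly phi f)^`M(i) = map_mpoly phi f^`M(i).
Proof.
apply/mpolyP => m.
by rewrite mcoeff_deriv !mcoeff_map_mpoly mcoeff_deriv /= raddfMn.
Qed.

Lemma map_mpoly_homogeneous f : homogeneous f -> homogeneous (map_mpoly phi f).
Proof.
move=> [d /dhomogP hf]; exists d; apply/dhomogP => m.
rewrite mcoeff_msupp mcoeff_map_mpoly fmorph_eq0 -mcoeff_msupp.
exact: hf.
Qed.

Lemma map_gradient f x :
  gradient (map_mpoly phi f) (map_mx phi x) = map_mx phi (gradient f x).
Proof. by apply/rowP => j; rewrite !mxE map_mpoly_mderiv map_mpoly_meval_mx. Qed.

Lemma map_jacobian_minor m (h : 'I_m -> {mpoly F[n]}) V :
  map_mpoly phi (jacobian_minor h V) =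
  jacobian_minor (fun i => map_mpoly phi (h i)) (map_mx phi V).
Proof.
rewrite -det_map_mx; congr (\det _); apply/matrixP => i j.
rewrite !mxE raddf_sum /=; apply: eq_bigr => a _.
by rewrite rmorphM /= map_mpoly_mderiv map_mpolyC mxE.
Qed.

End MapMpoly.

Lemma gradientD (F : fieldType) (n : nat) (f g : {mpoly F[n]}) x :
  gradient (f + g) x = gradient f x + gradient g x.
Proof. by apply/rowP => j; rewrite !mxE mderivD mevalD. Qed.

Lemma gradient_scale (F : fieldType) (n : nat) a (f : {mpoly F[n]}) x :
  gradient (a *: f) x = a *: gradient f x.
Proof. by apply/rowP => j; rewrite !mxE mderivZ mevalZ. Qed.

Section RealForm.
Variables (R : realType) (n : nat).
Local Notation iota := (real_complex R).
Local Notation im := ('i%C : R[i]).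

Lemma mpoly_ReIm (f : {mpoly R[i][n]}) : exists f1 f2 : {mpoly R[n]},
  f = map_mpoly iota f1 + im *: map_mpoly iota f2 /\
  (homogeneous f -> homogeneous f1 /\ homogeneous f2).
Proof.
pose part (u : R[i] -> R) : {mpoly R[n]} := \sum_(m <- msupp f) u f@_m *: 'X_[m].
exists (part (@complex.Re R)), (part (@complex.Im R)); split.
  rewrite /part [map_mpoly _ _]raddf_sum.
  rewrite [map_mpoly iota (\sum_(m <- _) complex.Im _ *: _)]raddf_sum.
  rewrite scaler_sumr -big_split /= [LHS]mpolyE.
  apply: eq_bigr => m _; rewrite !map_mpolyZ !map_mpolyX scalerA -scalerDl.
  by rewrite -complexE.
move=> [d /dhomogP hf].
by split; exists d; rewrite /part big_seq; apply: dhomog_sum => m fm;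
   apply: dhomogZ; rewrite dhomogX; apply/eqP/hf.
Qed.

Lemma map_mpoly_conj (g : {mpoly R[n]}) :
  map_mpoly (@conjc R) (map_mpoly iota g) = map_mpoly iota g.
Proof.
apply/mpolyP => m; rewrite [LHS](mcoeff_map_mpoly (@conjc R)) mcoeff_map_mpoly.
by rewrite /= oppr0.
Qed.

Lemma meval_conj (g : {mpoly R[n]}) (x : 'rV[R[i]]_n) :
  (map_mpoly iota g).@[(map_mx (@conjc R) x) ord0] =
  ((map_mpoly iota g).@[x ord0])^*%C.
Proof. by rewrite -[in LHS]map_mpoly_conj (map_mpoly_meval_mx (@conjc R)). Qed.

Lemma complex_conj_eq0 (a b : R[i]) : a + im * b = 0 ->
  (a^*)%C + im * (b^*)%C = 0 -> a = 0 /\ b = 0.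
Proof.
case: a b => [a1 a2] [b1 b2] /eqP; rewrite eq_complex /= => /andP[/eqP e1 /eqP e2].
move=> /eqP; rewrite eq_complex /= => /andP[/eqP e3 /eqP e4].
suff [-> -> -> ->] : [/\ a1 = 0, a2 = 0, b1 = 0 & b2 = 0] by [].
by split; lra.
Qed.

Variable X : set (Gr R[i] 1 n).
Hypothesis realX : defined_over_reals X.

Definition real_vanishing (g : {mpoly R[n]}) :=
  homogeneous g /\ vanishing X (map_mpoly iota g).

Lemma zariski_closed_real : zariski_closed (@pcoord _ n) X.
Proof.
have [E hE XE] := realX; exists [set map_mpoly iota f | f in E].
  by move=> _ [f Ef <-]; apply/map_mpoly_homogeneous/hE.
rewrite XE; apply/seteqP; split=> p /= pE f; last by move=> Ef; apply: pE; exists f.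
by move=> [g Eg <-]; apply: pE.
Qed.

Lemma real_equations p (x : 'rV[R[i]]_n) : x != 0 -> (x <= Gr_mx p)%MS ->
  X p <-> forall g, real_vanishing g -> (map_mpoly iota g).@[x ord0] = 0.
Proof.
move=> x0 xp; split=> [Xp g [hg [hg' gX]]|gx].
  by apply/(homogeneous_meval0 hg' x0 xp); apply: gX.
have [E hE XE] := realX; rewrite XE => f Ef.
apply/(homogeneous_meval0 (map_mpoly_homogeneous iota (hE f Ef)) x0 xp).
apply: gx; split; first exact: hE.
split; first exact/map_mpoly_homogeneous/hE.
by move=> q; rewrite XE; apply.
Qed.

Lemma conj_closed p : X p -> exists2 q, X q &
  (map_mx (@conjc R) (Gr_mx p) <= Gr_mx q)%MS.
Proof.
move=> Xp; have x0 : map_mx (@conjc R) (Gr_mx p) != 0.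
  by rewrite map_mx_eq0 Gr1_mx_neq0.
have xq : (map_mx (@conjc R) (Gr_mx p) <= Gr_mx (Gr_span (rV_free x0)))%MS.
  by rewrite Gr_spanK.
exists (Gr_span (rV_free x0)) => //; apply/(real_equations x0 xq) => g gX.
by rewrite meval_conj; have [_ [_ /(_ p Xp) ->]] := gX; rewrite rmorph0.
Qed.

(** [X] contains the conjugates of its points, and vanishing of [f] at a point and at its conjugate
    separates the two parts. *)
Lemma vanishing_ReIm f : vanishing X f -> exists f1 f2,
  [/\ f = map_mpoly iota f1 + im *: map_mpoly iota f2,
      real_vanishing f1 & real_vanishing f2].
Proof.
move=> [hf fX]; have [f1 [f2 [fE /(_ hf)[h1 h2]]]] := mpoly_ReIm f.
have h1' := map_mpoly_homogeneous iota h1.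
have h2' := map_mpoly_homogeneous iota h2.
suff zero p : X p -> (map_mpoly iota f1).@[pcoord p] = 0 /\
    (map_mpoly iota f2).@[pcoord p] = 0.
  exists f1, f2; split; first exact: fE.
    by split; [exact: h1|split; [exact: h1'|move=> p /zero[]]].
  by split; [exact: h2|split; [exact: h2'|move=> p /zero[]]].
move=> Xp; have [q Xq xq] := conj_closed Xp.
have x0 : map_mx (@conjc R) (Gr_mx p) != 0 by rewrite map_mx_eq0 Gr1_mx_neq0.
have f1p : f.@[pcoord p] = 0 := fX p Xp.
have fq : f.@[(map_mx (@conjc R) (Gr_mx p)) ord0] = 0.
  by apply/(homogeneous_meval0 hf x0 xq); apply: fX.
apply: complex_conj_eq0; first by rewrite -f1p fE mevalD mevalZ.
have conj1 := meval_conj f1 (Gr_mx p); have conj2 := meval_conj f2 (Gr_mx p).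
have fq' := fq; rewrite fE mevalD mevalZ in fq'.
exact: etrans (congr2 (fun u v => u + im * v) (esym conj1) (esym conj2)) fq'.
Qed.

(** This allows the independent differentials at a real point to be taken from real equations,
    although transversality refers to the complex tangent space. *)
Lemma tangent_space_real p (x v : 'rV[R[i]]_n) : x != 0 -> (x <= Gr_mx p)%MS ->
  (v <= tangent_space X p)%MS <->
  forall g, real_vanishing g -> gradient (map_mpoly iota g) x *m v^T = 0.
Proof.
move=> x0 xp; rewrite (tangent_space_gradient X v x0 xp).
split=> [Tv g [_ gX]|Tv f /vanishing_ReIm[f1 [f2 [-> f1X f2X]]]]; first exact: Tv.
have e1 := Tv f1 f1X; have e2 := Tv f2 f2X.
rewrite gradientD gradient_scale mulmxDl -scalemxAl.
apply: etrans (congr2 (fun u w => u + im *: w) e1 e2) _.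
by rewrite scaler0 addr0.
Qed.

End RealForm.


(** [plucker] reads the frame chosen by the quotient, which need not vary continuously; the minors
    of an arbitrary frame are polynomials in its entries. *)
Definition minors (F : fieldType) (k n : nat) (A : 'M[F]_(k, n)) :
    'I_#|increasing k n| -> F :=
  fun s => \det (colsub (enum_val s) A).

Lemma meval_plucker_frame (F : fieldType) (k n : nat)
    (f : {mpoly F[#|increasing k n|]}) (L : Gr F k n) (A : 'M[F]_(k, n)) :
  homogeneous f -> (A == Gr_mx L)%MS ->
  (f.@[minors A] == 0) = (f.@[plucker L] == 0).
Proof.
move=> [d hf] eqAL; have /andP[/submxP[D AD] _] := eqAL.
have Du : D \in unitmx.
  rewrite -row_full_unit /row_full eqn_leq rank_leq_col /=.
  rewrite -[X in (X <= _)%N](eqP (Gr_mx_free L)) -(eqmx_rank eqAL) AD.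
  exact: mxrankM_maxl.
have -> : f.@[minors A] =
    \det D ^+ d * f.@[plucker L].
  rewrite -(dhomog_mevalZ _ _ hf); apply: meval_eq => s.
  rewrite /minors AD -det_mulmx; congr (\det _).
  by apply/matrixP => i j; rewrite !mxE; apply: eq_bigr => a _; rewrite mxE.
by rewrite mulf_eq0 expf_eq0 -[\det D == 0]negbK -unitfE -unitmxE Du andbF.
Qed.

(** * Transversality and real zeros under perturbation *)

Section Final.
Variables (R : realType) (c e k : nat) (X : set (Gr R[i] 1 (c + e))).
Local Notation iota := (real_complex R).
Hypothesis realX : defined_over_reals X.
Hypothesis rankX : forall p, X p -> \rank (tangent_space X p) = e.

Lemma complexify_frame (A : 'M[R]_(k, c + e)) (freeA : row_free A) :
  (map_mx iota A == Gr_mx (complexify (Gr_span freeA)))%MS.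
Proof.
by rewrite /complexify !Gr_spanK !map_submx !Gr_spanK submx_refl.
Qed.

Lemma complexify_mx (V : Gr R k (c + e)) :
  (map_mx iota (Gr_mx V) :=: Gr_mx (complexify V))%MS.
Proof. by apply/eqmx_sym; rewrite /complexify; apply: Gr_spanK. Qed.

Lemma meval_minors_lipschitz (f : {mpoly R[#|increasing k (c + e)|]}) :
  loc_lipschitz (fun (_ : 'rV[R]_k) (M : 'M[R]_(k, c + e)) => f.@[minors M]).
Proof.
apply: loc_lipschitz_meval => s; apply: loc_lipschitz_det => i j.
apply: eq_loc_lipschitz (loc_lipschitz_mx i (enum_val s j)) => y M.
by rewrite mxE.
Qed.

(** At real minors the separating polynomial vanishes only if its real and imaginary parts both do;
    a part that is nonzero at [A] stays nonzero nearby. *)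
Lemma transverse_near (A : 'M[R]_(k, c + e)) (freeA : row_free A) :
  transverse (complexify (Gr_span freeA)) X ->
  exists2 r, 0 < r & forall (M : 'M[R]_(k, c + e)) (freeM : row_free M),
    box r (M - A) -> transverse (complexify (Gr_span freeM)) X.
Proof.
move=> trA.
have [f [hf fA] f0] := transverse_separation
  (@complex_infinite_fibers R) (zariski_closed_real realX) rankX trA.
have [f1 [f2 [fE _]]] := mpoly_ReIm f.
have f_minors M (freeM : row_free M) :
    (f.@[plucker (complexify (Gr_span freeM))] == 0) =
    (f1.@[minors M] == 0) && (f2.@[minors M] == 0).
  rewrite -(meval_plucker_frame hf (complexify_frame freeM)).
  have -> : f.@[minors (map_mx iota M)] =
      f.@[fun s => iota (minors M s)].
    apply: meval_eq => s; rewrite /minors -det_map_mx; congr (\det _).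
    by apply/matrixP => i j; rewrite !mxE.
  rewrite {1}fE mevalD mevalZ.
  have e1 := meval_map_mpoly iota f1 (minors M).
  have e2 := meval_map_mpoly iota f2 (minors M).
  rewrite (congr2 (fun a b => a + 'i%C * b == 0) e1 e2) eq_complex /=.
  by rewrite !(mul0r, mul1r, subr0, addr0, add0r, mulr0, subrr).
have nbhd g : g.@[minors A] != 0 -> exists2 r, 0 < r & forall M : 'M[R]_(k, c + e),
    box r (M - A) -> g.@[minors M] != 0.
  move=> gA; have [r [eta [/andP[r0 _] eta0 gM]]] :=
    loc_lipschitz_neq0 (y0 := 0) (meval_minors_lipschitz g) gA.
  exists r => // M Mr; rewrite -normr_gt0; apply: lt_le_trans eta0 _.
  by apply: (gM 0 M) => //; rewrite subrr; apply: box0; apply: ltW.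
have tr M (freeM : row_free M) : f.@[plucker (complexify (Gr_span freeM))] != 0 ->
    transverse (complexify (Gr_span freeM)) X.
  by move=> fM; apply: contrapT => /f0 /eqP; rewrite (negPf fM).
move: fA; rewrite f_minors negb_and => /orP[|] /nbhd[r r0 rP];
  exists r => // M freeM Mr; apply: tr;
  by rewrite f_minors negb_and rP ?orbT.
Qed.

Variable Gs : seq {mpoly R[c + e]}.
Hypothesis Gs_vanishing : forall g, g \in Gs -> real_vanishing X g.
Hypothesis Gs_span :
  forall g, real_vanishing X g -> ideal_span (fun p => p \in Gs) g.

Definition has_real_zero (V : Gr R k (c + e)) := exists x : 'rV[R]_(c + e),
  [/\ x != 0, (x <= Gr_mx V)%MS & forall g, g \in Gs -> g.@[x ord0] = 0].

Lemma real_points_zero p (x : 'rV[R]_(c + e)) : x != 0 ->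
  (map_mx iota x <= Gr_mx p)%MS ->
  X p <-> forall g, g \in Gs -> g.@[x ord0] = 0.
Proof.
move=> x0 xp; have ix0 : map_mx iota x != 0 by rewrite map_mx_eq0.
have zero g : (map_mpoly iota g).@[(map_mx iota x) ord0] = 0 <-> g.@[x ord0] = 0.
  have E := map_mpoly_meval_mx iota g x.
  split=> [/(etrans (esym E))/eqP|g0].
    by rewrite fmorph_eq0 => /eqP.
  by apply: etrans E _; rewrite g0 rmorph0.
apply: iff_trans (real_equations realX ix0 xp) _; split=> [gx g gGs|gx g].
  by apply/zero; apply: gx; apply: Gs_vanishing.
move=> /Gs_span gS; apply/zero; elim: gS => [|u p' h pGs _ IH].
  by rewrite meval0.
by rewrite mevalD mevalM (gx _ pGs) mulr0 add0r.
Qed.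

Lemma has_real_zeroP (V : Gr R k (c + e)) :
  points (complexify V) `&` real_points X = set0 <-> ~ has_real_zero V.
Proof.
split=> [noV [x [x0 xV gx]]|nmeet].
  pose q := Gr_span (rV_free x0).
  have xq : (map_mx iota x <= Gr_mx (complexify q))%MS.
    by rewrite /complexify Gr_spanK map_submx Gr_spanK.
  have : (points (complexify V) `&` real_points X) (complexify q).
    split; last by split; [exact/(real_points_zero x0 xq)|exists q].
    rewrite /points /= -complexify_mx /complexify Gr_spanK map_submx.
    by rewrite Gr_spanK.
  by rewrite noV.
apply/seteqP; split=> // p [Vp [Xp [q _ qp]]]; apply: nmeet.
exists (Gr_mx q); split; first exact: Gr1_mx_neq0.
  by move: Vp; rewrite /points /= -qp -complexify_mx /complexify Gr_spanK map_submx.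
apply/(real_points_zero (p := p) (Gr1_mx_neq0 q)) => //.
by rewrite -qp /complexify Gr_spanK.
Qed.

Lemma max_norm_scale (y : 'rV[R]_k) : y != 0 ->
  exists2 t, t != 0 & box 1 (t *: y) /\ exists i, `|(t *: y) 0 i| = 1.
Proof.
move=> /rV0Pn[i0 yi0]; pose i := [arg max_(j > i0) `|y 0 j|]%O.
have ymax j : `|y 0 j| <= `|y 0 i|.
  by rewrite /i; case: arg_maxP => // a _; apply.
have yi : 0 < `|y 0 i| by apply: lt_le_trans (ymax i0); rewrite normr_gt0.
exists `|y 0 i|^-1; first by rewrite invr_eq0 gt_eqF.
split=> [a j|].
  by rewrite mxE ord1 normrM normfV normr_id mulrC ler_pdivrMr ?mul1r.
by exists i; rewrite mxE normrM normfV normr_id mulVf // gt_eqF.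
Qed.

Lemma no_real_zero_open : open [set V : Gr R k (c + e) | ~ has_real_zero V].
Proof.
apply: Gr_open => A freeA nmeet; apply: contrapT => far.
(* Together with [box 1] around 0, the vanishing of this product puts [y] on the unit sphere of the
   maximum norm, so that the limit of normalized zeros is not 0. *)
pose unit_face : {mpoly R[k]} := \prod_(i < k) ('X_i ^+ 2 - 1).
have unit_faceE (y : 'rV[R]_k) :
    unit_face.@[y ord0] = \prod_(i < k) ((y ord0 i) ^+ 2 - 1).
  rewrite /unit_face rmorph_prod; apply: eq_bigr => i _.
  by rewrite /= mevalB rmorphXn /= mevalXU meval1.
pose ps := unit_face :: [seq g \mPo linear_forms A | g <- Gs].
have [d d0|y [_ yps]] := @compact_zero R k ps 0 1; last first.
  apply: nmeet; exists (y *m A); split.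
  - have : unit_face.@[y ord0] = 0 by apply: yps; rewrite inE eqxx.
    apply: contra_eqN => /eqP yA0; have -> : y = 0.
      by apply: (row_free_inj freeA); rewrite mul0mx.
    rewrite unit_faceE; under eq_bigr do rewrite mxE expr0n sub0r.
    by rewrite prodf_seq_neq0; apply/allP => i _; rewrite oppr_eq0 oner_eq0.
  - by rewrite Gr_spanK submxMl.
  - move=> g gGs; rewrite -meval_linear_forms; apply: yps.
    by rewrite inE map_f ?orbT.
have lip g : loc_lipschitz
    (fun (y : 'rV[R]_k) (M : 'M[R]_(k, c + e)) => g.@[(y *m M) ord0]).
  exact: loc_lipschitz_poly.
have [B B0 BA] := box_exists A.
have [g gGs|g C D C0 CP CD|C C0 CP] := @finite_bound_seq R _ Gs (fun g C =>
  forall (y : 'rV[R]_k) (M M' : 'M[R]_(k, c + e)) r, box (B + 1) y ->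
    box (B + 1) M -> box (B + 1) M' -> 0 <= r <= 1 ->
    box r (M' - M) -> `|g.@[(y *m M') ord0] - g.@[(y *m M) ord0]| <= C * r).
- have [C C0 CP] := lip g (B + 1); exists C => // y M M' r By BM BM' r01 MM'.
  have [|//] := CP y M y M' r By BM By BM' r01 _ MM'.
  by rewrite subrr; apply: box0; case/andP: r01.
- move=> y M M' r By BM BM' r01 MM'; apply: le_trans (CP y M M' r By BM BM' r01 MM') _.
  by rewrite ler_wpM2r //; case/andP: r01.
have C1 : 0 < C + 1 by apply: ltr_wpDl.
pose r := Num.min 1 (d / (C + 1)).
have r0 : 0 < r by rewrite lt_min ltr01 divr_gt0.
have r1 : r <= 1 by rewrite ge_min lexx.
have Cr : C * r <= d.
  apply: (@le_trans _ _ ((C + 1) * (d / (C + 1)))).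
    by rewrite ler_pM ?(ltW r0) ?ge_min ?lexx ?orbT // lerDl.
  by rewrite mulrCA divff ?mulr1 // gt_eqF.
have [M [freeM [Mr [x [x0 xM gx]]]]] : exists M (freeM : row_free M),
    box r (M - A) /\ has_real_zero (Gr_span freeM).
  apply: contrapT => noM; apply: far; exists r => // M freeM Mr meetM.
  by apply: noM; exists M, freeM.
have [z xz] : exists z, x = z *m M by apply/submxP; rewrite Gr_spanK in xM.
have z0 : z != 0 by apply: contraNneq x0 => z0; rewrite xz z0 mul0mx.
have [t t0 [tz1 [i tzi]]] := max_norm_scale z0.
exists (t *: z); split=> [|p]; first by rewrite subr0.
rewrite inE => /predU1P[->|/mapP[g gGs ->]].
  rewrite unit_faceE (bigD1 i) //= -[X in X - 1]real_normK ?num_real // tzi.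
  by rewrite expr1n subrr mul0r normr0 ltW.
rewrite meval_linear_forms; have BA1 : box (B + 1) A by apply: boxW BA _; rewrite lerDl.
have BM1 : box (B + 1) M by apply: box_shift BA (boxW Mr _).
have Bz1 : box (B + 1) (t *: z) by apply: boxW tz1 _; rewrite lerDr.
have r01 : 0 <= r <= 1 by rewrite ltW.
have AM : box r (A - M) by rewrite -opprB; apply: boxN.
have gM : g.@[((t *: z) *m M) ord0] = 0.
  have [[a hg] _] := Gs_vanishing gGs.
  rewrite -scalemxAl -xz -[RHS](mulr0 (t ^+ a)) -(gx g gGs) -(dhomog_mevalZ _ _ hg).
  by apply: meval_eq => j; rewrite mxE.
have := CP g gGs (t *: z) M A r Bz1 BM1 BA1 r01 AM.
by rewrite gM subr0 => /le_trans; apply.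
Qed.

Lemma real_vanishing_minor (h : 'I_(c + 1) -> {mpoly R[c + e]}) V :
  (forall i, real_vanishing X (h i)) -> real_vanishing X (jacobian_minor h V).
Proof.
move=> hX; have hom := jacobian_minor_homogeneous V (fun i => (hX i).1).
split=> //; split=> [|p Xp]; first exact: map_mpoly_homogeneous.
rewrite map_jacobian_minor; apply: etrans (jacobian_minorE _ _ _) _.
set J := jacobian _ _; have JT : J *m (tangent_space X p)^T = 0.
  apply/matrixP => i j; rewrite [RHS]mxE.
  have := (tangent_space_gradient X (row j (tangent_space X p)) (Gr1_mx_neq0 p)
    (submx_refl _)).1 (row_sub _ _) _ (hX i).2.
  move=> /(congr1 (fun B : 'M_1 => B 0 0)); rewrite [RHS]mxE => <-.
  by rewrite !mxE; apply: eq_bigr => a _; rewrite !mxE.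
have rankJ : (\rank J <= c)%N.
  have := mulmx0_rank_max JT; rewrite mxrank_tr rankX //.
  by rewrite leq_add2r.
apply: contrapT => /eqP; rewrite -unitfE -unitmxE => Ju.
have := mxrankM_maxl J (map_mx iota V)^T.
by rewrite mxrank_unit // => /leq_trans/(_ rankJ); rewrite addn1 ltnn.
Qed.

Lemma real_zero_near (A : 'M[R]_(k, c + e)) (freeA : row_free A) :
  has_real_zero (Gr_span freeA) -> transverse (complexify (Gr_span freeA)) X ->
  exists2 r, 0 < r & forall (M : 'M[R]_(k, c + e)) (freeM : row_free M),
    box r (M - A) -> has_real_zero (Gr_span freeM).
Proof.
move=> [x [x0 xA gx]] trA; have ix0 : map_mx iota x != 0 by rewrite map_mx_eq0.
pose p := Gr_span (rV_free ix0).
have xp : (map_mx iota x <= Gr_mx p)%MS by rewrite Gr_spanK.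
have Xp : X p by apply/(real_points_zero x0 xp).
have pA : points (complexify (Gr_span freeA)) p.
  by rewrite /points /= Gr_spanK -complexify_mx map_submx.
have full : row_full (map_mx iota A + tangent_space X p)%MS.
  rewrite -sub1mx (submx_trans (submx_full _ (trA p pA Xp))) // addsmxS //.
  by case/andP: (complexify_frame freeA).
pose Phi := [set map_mx iota (gradient g x) | g in real_vanishing X].
have T_ann (v : 'rV[R[i]]_(c + e)) : (v <= tangent_space X p)%MS <->
    forall u, Phi u -> u *m v^T = 0.
  apply: iff_trans (tangent_space_real realX v ix0 xp) _.
  split=> [Tv _ [g gX <-]|Tv g gX].
    by apply: etrans (Tv g gX); rewrite map_gradient.
  rewrite map_gradient; apply: Tv; by exists g.
have [B PhiB [s detB]] := annihilator_det_exists T_ann (rankX Xp) full.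
have /choice[f fB] (a : 'I_c) : exists f, real_vanishing X f /\
    map_mx iota (gradient f x) = row a B.
  by have [f fX fB] := PhiB a; exists f.
have BE : B = map_mx iota (jacobian f x).
  apply/row_matrixP => a; rewrite -(fB a).2; apply/rowP => j.
  by rewrite !mxE.
have [y xy] : exists y, x = y *m A by apply/submxP; rewrite Gr_spanK in xA.
have y0 : y != 0 by apply: contraNneq x0 => y0; rewrite xy y0 mul0mx.
have detf : \det (jacobian f (y *m A) *m (rowsub s A)^T) != 0.
  rewrite -xy -(fmorph_eq0 iota) -det_map_mx map_mxM -BE.
  by rewrite -map_trmx map_mxsub.
have minors_span g l : g \in Gs -> ideal_span (fun q => q \in Gs)
    (jacobian_minor (snoc f g) (col_mx (rowsub s A) (delta_mx 0 l))).
  move=> /Gs_vanishing gX; apply/Gs_span/real_vanishing_minor => i.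
  rewrite /snoc; case: (split i) => [a|_]; first exact: (fB a).1.
  exact: gX.
have gy g : g \in Gs -> g.@[(y *m A) ord0] = 0 by rewrite -xy; apply: gx.
have /rV0Pn[i yi] := y0.
(* This radius keeps the [i]-th coordinate of the new [z] away from 0, so that [z *m M] defines a
   projective point. *)
have rho0 : 0 < `|y 0 i| / 2 by rewrite divr_gt0 ?normr_gt0.
have [r r0 rP] := flow_zero detf minors_span gy rho0.
exists r => // M freeM /rP[z [zy gz]]; exists (z *m M); split=> //.
  apply: contraTneq (zy 0 i) => zM0; rewrite -ltNge.
  have -> : z = 0 by apply: (row_free_inj freeM); rewrite mul0mx.
  rewrite !mxE sub0r normrN ltr_pdivrMr // ltr_pMr ?ltr1n // normr_gt0 //.
by rewrite Gr_spanK submxMl.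
Qed.

Lemma avoidance_locusE : avoidance_locus X k =
  [set V : Gr R k (c + e) | transverse (complexify V) X /\ ~ has_real_zero V].
Proof.
apply/seteqP; split=> V [trV noV]; split=> //; exact/has_real_zeroP.
Qed.

Lemma transverse_open : open [set V : Gr R k (c + e) | transverse (complexify V) X].
Proof. exact: Gr_open transverse_near. Qed.

Lemma real_zero_open :
  open [set V : Gr R k (c + e) | transverse (complexify V) X /\ has_real_zero V].
Proof.
apply: Gr_open => A freeA [trA meetA].
have [r r0 rP] := transverse_near trA; have [r' r'0 r'P] := real_zero_near meetA trA.
exists (Num.min r r'); first by rewrite lt_min r0.
move=> M freeM Mr; split.
  by apply/rP/(boxW Mr); rewrite ge_min lexx.
by apply/r'P/(boxW Mr); rewrite ge_min lexx orbT.
Qed.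

End Final.


(** * Coisotropic varieties, regions and the conclusion *)

Section Dimension.
Variables (F : fieldType) (n : nat) (X : set (Gr F 1 n)).

Lemma has_chain_le (m m' : nat) : (m' <= m)%N -> has_chain X m -> has_chain X m'.
Proof.
move=> mm' [Z [ZX Zlt]]; exists Z; split=> i im'.
  by apply: ZX; apply: leq_trans mm'.
by apply: Zlt; apply: leq_trans mm'.
Qed.

Lemma variety_dim_unique (d d' : nat) :
  variety_dim X d -> variety_dim X d' -> d = d'.
Proof.
move=> [Xd nXd] [Xd' nXd']; case: (ltngtP d d') => // lt.
  by case: (nXd (has_chain_le lt Xd')).
by case: (nXd' (has_chain_le lt Xd)).
Qed.

Lemma smooth_variety_rank (d : nat) : variety_dim X d -> smooth_variety X ->
  forall p, X p -> \rank (tangent_space X p) = d.+1.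
Proof.
by move=> dimX smoothX p /smoothX[_ [d' /(variety_dim_unique dimX) <-]].
Qed.

(** [k + d - n + 1] is the rank of the intersection when [L] and the tangent space span, their ranks
    being [k] and [d.+1]; [n <= k + d] makes the truncated subtraction exact. *)
Lemma coisotropicP (k d : nat) (L : Gr F k n) :
  (n <= k + d)%N -> smooth_variety X ->
  (forall p, X p -> \rank (tangent_space X p) = d.+1) ->
  (exists p, [/\ smooth_point X p, points L p &
    (k + d - n + 1 < \rank (Gr_mx L :&: tangent_space X p)%MS)%N]) <->
  ~ transverse L X.
Proof.
move=> le_n smoothX rankX.
have rankE p : X p ->
    (k + d - n + 1 < \rank (Gr_mx L :&: tangent_space X p)%MS)%N =
    ~~ row_full (Gr_mx L + tangent_space X p)%MS.
  move=> Xp; have := mxrank_sum_cap (Gr_mx L) (tangent_space X p).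
  rewrite (eqP (Gr_mx_free L)) rankX // /row_full.
  have := rank_leq_col (Gr_mx L + tangent_space X p)%MS.
  move: (\rank _) (\rank _) => a b an ab; apply/idP/idP => [lt|ne].
    by apply/eqP; lia.
  by move/eqP: ne; lia.
split=> [[p [[Xp _] Lp]]|].
  by rewrite rankE // => /negP nfull trL; apply/nfull/trL.
move=> /existsNP[p /not_implyP[Lp /not_implyP[Xp /negP nfull]]].
by exists p; split=> //; [exact: smoothX|rewrite rankE].
Qed.

End Dimension.

(** The Zariski closure adds nothing: for transverse [L] the separating polynomial defines a closed
    set that contains all non-transverse subspaces but not [L]. *)
Lemma coisotropic_transverse (K : numClosedFieldType) (c d k : nat)
    (X : set (Gr K 1 (c + d.+1))) (L : Gr K k (c + d.+1)) :
  infinite_fibers K -> zariski_closed (@pcoord K (c + d.+1)) X ->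
  smooth_variety X -> (forall p, X p -> \rank (tangent_space X p) = d.+1) ->
  (c + d.+1 <= k + d)%N ->
  ~ coisotropic X k (k + d - (c + d.+1) + 1) L <-> transverse L X.
Proof.
move=> infK closedX smoothX rankX le_n; split=> [nCH|trL CH].
  apply: contrapT => ntr; apply: nCH; apply: (sub_smallest (fun _ => id)).
  exact/(coisotropicP L le_n smoothX rankX).
have [f [hf fL] f0] := transverse_separation infK closedX rankX trL.
suff /(_ _ CH)/eqP : coisotropic X k (k + d - (c + d.+1) + 1) `<=`
    [set L' | f.@[plucker L'] = 0] by rewrite (negPf fL).
apply: smallest_sub => [|L' /(coisotropicP L' le_n smoothX rankX)/f0 //].
exists [set f] => [g -> //|].
by apply/seteqP; split=> L' => [fL' g -> //|]; apply.
Qed.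

(** [A] is open and, as the complement of [B], closed in [U], so a component of [U] that meets [A]
    stays inside it. *)
Lemma union_of_components (T : topologicalType) (U A B : set T) :
  open A -> open B -> U = A `|` B -> A `&` B = set0 ->
  A = \bigcup_(C in [set connected_component U x | x in A]) C.
Proof.
move=> oA oB UE AB0; have AU : A `<=` U by rewrite UE; apply: subsetUl.
apply/seteqP; split=> [x Ax|y [_ [x Ax <-] Cy]].
  exists (connected_component U x); first by exists x.
  exact/connected_component_refl/AU.
set C := connected_component U x in Cy.
have CU : C `<=` U := @connected_component_sub _ _ _.
have Cx : C x by apply/connected_component_refl/AU.
suff CA : C `&` A = C by move: Cy; rewrite -CA => -[].
apply: component_connected; first by exists x.
  by exists A.
exists (~` B); first exact: open_closedC.
apply/seteqP; split=> z [Cz zP]; split=> //.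
  by move=> Bz; have : (A `&` B) z by []; rewrite AB0.
by have := CU z Cz; rewrite UE => -[].
Qed.

Theorem theorem2p19 (R : realType) (n d k : nat) (X : set (Gr R[i] 1 n)) :
  projective_variety X -> variety_dim X d -> smooth_variety X ->
  nondegenerate_variety X -> totally_real X ->
  (n <= k + d)%N -> (k <= n - 1)%N ->
  open (avoidance_locus X k) /\
  exists2 S : set (set (Gr R k n)), S `<=` region X k (k + d - n + 1)%N &
    avoidance_locus X k = \bigcup_(U in S) U.
Proof.
move=> [closedX [[p0 Xp0] _]] dimX smoothX _ [realX _] le_n _.
have rankX := smooth_variety_rank dimX smoothX.
(* A point of [X] shows [d.+1 <= n], as the rank of its tangent space. The number [c] is the
   codimension, and [n] as a sum has the form required of the matrix sizes. *)
have [c nE] : exists c, n = (c + d.+1)%N.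
  by exists (n - d.+1)%N; rewrite subnK // -(rankX _ Xp0) rank_leq_col.
subst n.
have [Gs GsX Gs_span] := hilbert_basis (real_vanishing X).
have AE := avoidance_locusE k realX GsX Gs_span.
pose U := ~` (@complexify R k (c + d.+1) @^-1` coisotropic X k (k + d - (c + d.+1) + 1)).
have UE V : U V <-> transverse (complexify V) X.
  exact: coisotropic_transverse (@complex_infinite_fibers R) closedX smoothX rankX le_n.
have openA : open (avoidance_locus X k).
  rewrite AE; apply: openI; first exact: transverse_open realX rankX.
  exact: no_real_zero_open GsX.
split=> //; exists [set connected_component U V | V in avoidance_locus X k].
  by move=> _ [V AV <-]; exists V => //; apply/UE; move: AV; rewrite AE => -[].
have openB := real_zero_open k realX rankX GsX Gs_span.
apply: (@union_of_components _ U _ _ openA openB).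
  rewrite AE; apply/seteqP; split=> V; last by move=> [[]|[]] trV _; apply/UE.
  by move=> /UE trV; have [mV|nmV] := pselect (has_real_zero Gs V); [right|left].
by rewrite AE; apply/seteqP; split=> // V [[_ nmV] [_ /nmV]].
Qed.
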